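(* Let $M$ be a surface isometrically immersed in $\mathbb{E}^3$ with angle function $\theta$ taking values in $(0,\pi)\setminus\{\frac{\pi}{2}\}$, and suppose that the tangential part $U$ of $\overrightarrow{k}$ is a canonical principal direction. Then, locally and up to isometries of $\mathbb{E}^3$, there are coordinates $(x,y)$ on $M$ in which $\theta=\theta(x)$ depends only on $x$ and in which the immersion $r:M\to\mathbb{E}^3$ is given by one of the following, where in both cases $\phi(x)$ denotes a primitive of $\cos\theta(x)$: Case 1. $$r(x,y)=\left(\phi(x)(\cos y,\ \sin y)+\gamma(y),\ \int_0^x\sin\theta(\tau)\,d\tau\right),$$ where $$\gamma(y)=\left(-\int_0^y \psi(\tau)\sin\tau\, d\tau,\ \int_0^y \psi(\tau)\cos\tau\, d\tau\right)$$ for some smooth real function $\psi$ of one variable. Case 2. $$r(x,y)=\left(\phi(x)\cos y_0,\ \phi(x)\sin y_0,\ \int_0^x\sin\theta(\tau)\,d\tau\right)+y\,\mathrm{v}_0,$$ where $\mathrm{v}_0=(-\sin y_0,\ \cos y_0,\ 0)$ and $y_0\in\mathbb{R}$ (these surfaces are cylinders).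
   Context: $\mathbb{E}^3$ is Euclidean 3-space with scalar product $\langle\cdot,\cdot\rangle$ and a fixed unit vector (fixed direction) $\overrightarrow{k}$. $M$ is a smooth surface isometrically immersed in $\mathbb{E}^3$ with unit normal $N$ and induced metric $g$; the shape operator $A$ is given by $\widetilde\nabla_X N=-AX$, where $\widetilde\nabla$ is the flat connection. The angle function is $\theta(p)=\angle(N(p),\overrightarrow{k})\in(0,\pi)$, and $U$ is the tangent part of $\overrightarrow{k}$: $\overrightarrow{k}=U+\cos\theta\,N$. ''$U$ is a principal direction'' means that $AU$ is everywhere a multiple of $U$. $U$ is called a canonical principal direction if it is a principal direction and the corresponding principal curvature is different from zero (so the angle function is not constant). All statements are local (in a neighborhood of any point of the surface) and all objects are smooth. The phrase ''up to isometries of $\mathbb{E}^3$'' includes moving $\overrightarrow{k}$ to the third coordinate vector $(0,0,1)$; in the parametrizations the third coordinate is along $\overrightarrow{k}$.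
   Formalization: ''Locally'' is proved around every point off the topological boundary of the set where det A = 0 (A the shape operator), shown to be an open dense set; near a boundary point neither Case 1 (det A nonzero) nor Case 2 (det A = 0) can hold, so the claim at every point is false. *)

(* Defs.v *)
From HB Require Import structures.
From mathcomp Require Import all_boot all_order all_algebra.
From mathcomp Require Import all_classical all_reals all_analysis.

Set Implicit Arguments.
Unset Strict Implicit.
Unset Printing Implicit Defensive.

Import Order.TTheory GRing.Theory Num.Theory.
Import numFieldNormedType.Exports.

Local Open Scope classical_set_scope.
Local Open Scope ring_scope.

(* C^oo on an open set D: all iterated directional derivatives of f are
   (Frechet) differentiable at every point of D.  Only the values of f on D
   matter, since D is open in all uses. *)
Definition smooth_on (R : realType) (V W : normedModType R) (D : set V)
    (f : V -> W) : Prop :=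
  forall (l : seq V) (x : V), D x ->
    differentiable (foldr (fun v (g : V -> W) => fun z => 'D_v g z) f l) x.

(* Euclidean structure of E^3; the norm that the library puts on 'rV_3 is the
   sup norm, which only serves to define the topology. *)
Definition dot (R : realType) (u v : 'rV[R]_3) : R := \sum_i u 0 i * v 0 i.

Definition enorm (R : realType) (u : 'rV[R]_3) : R := Num.sqrt (dot u u).

Definition angle (R : realType) (u v : 'rV[R]_3) : R :=
  acos (dot u v / (enorm u * enorm v)).

Definition euclidean_isometry (R : realType) (F : 'rV[R]_3 -> 'rV[R]_3) : Prop :=
  forall u v, enorm (F u - F v) = enorm (u - v).

Definition vec3 (R : realType) (a b c : R) : 'rV[R]_3 :=
  \row_(i < 3) [:: a; b; c]`_i.

Record chart (R : realType) (M : topologicalType) := Chart {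
  chart_dom : set M;
  chart_cod : set 'rV[R]_2;
  chart_to : M -> 'rV[R]_2;
  chart_inv : 'rV[R]_2 -> M;
  chart_dom_open : open chart_dom;
  chart_cod_open : open chart_cod;
  chart_toP : forall p, chart_dom p -> chart_cod (chart_to p);
  chart_invP : forall v, chart_cod v -> chart_dom (chart_inv v);
  chart_toK : forall p, chart_dom p -> chart_inv (chart_to p) = p;
  chart_invK : forall v, chart_cod v -> chart_to (chart_inv v) = v;
  chart_to_continuous : forall p, chart_dom p -> {for p, continuous chart_to};
  chart_inv_continuous : forall v, chart_cod v -> {for v, continuous chart_inv}
}.

Definition smooth_transition (R : realType) (M : topologicalType)
    (c c' : chart R M) : Prop :=
  smooth_on (chart_cod c `&` chart_inv c @^-1` chart_dom c')
    (chart_to c' \o chart_inv c).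

Definition smooth_surface (R : realType) (M : topologicalType)
    (atlas : set (chart R M)) : Prop :=
  [/\ hausdorff_space M, @second_countable M,
      (forall p : M, exists2 c, atlas c & chart_dom c p) &
      forall c c', atlas c -> atlas c' -> smooth_transition c c'].

(* A coordinate system on M: a chart of the maximal atlas. *)
Definition local_coordinates (R : realType) (M : topologicalType)
    (atlas : set (chart R M)) (c : chart R M) : Prop :=
  forall c', atlas c' -> smooth_transition c c' /\ smooth_transition c' c.

Definition smooth_map (R : realType) (M : topologicalType)
    (atlas : set (chart R M)) (f : M -> 'rV[R]_3) : Prop :=
  forall c, atlas c -> smooth_on (chart_cod c) (f \o chart_inv c).

(* Derivative at p of f along the tangent vector of M that has components v in
   the chart c. *)
Definition chart_derive (R : realType) (M : topologicalType) (c : chart R M)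
    (f : M -> 'rV[R]_3) (p : M) (v : 'rV[R]_2) : 'rV[R]_3 :=
  'D_v (f \o chart_inv c) (chart_to c p).

Definition smooth_immersion (R : realType) (M : topologicalType)
    (atlas : set (chart R M)) (r : M -> 'rV[R]_3) : Prop :=
  smooth_map atlas r /\
  forall c p v, atlas c -> chart_dom c p -> chart_derive c r p v = 0 -> v = 0.

(* Vectors tangent to M at p, identified with vectors of E^3 through dr. *)
Definition tangent (R : realType) (M : topologicalType)
    (atlas : set (chart R M)) (r : M -> 'rV[R]_3) (p : M) : set 'rV[R]_3 :=
  [set X | exists c v, [/\ atlas c, chart_dom c p & X = chart_derive c r p v]].

Definition unit_normal (R : realType) (M : topologicalType)
    (atlas : set (chart R M)) (r N : M -> 'rV[R]_3) : Prop :=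
  [/\ smooth_map atlas N,
      forall p, enorm (N p) = 1 &
      forall p X, tangent atlas r p X -> dot (N p) X = 0].

(* For X = dr(v) the derivative of N along X is dN(v), so this is
   nabla_X N = - A X.  It determines A p on the tangent plane at p; values of
   A p elsewhere are irrelevant. *)
Definition shape_operator (R : realType) (M : topologicalType)
    (atlas : set (chart R M)) (r N : M -> 'rV[R]_3)
    (A : M -> 'rV[R]_3 -> 'rV[R]_3) : Prop :=
  forall c p v, atlas c -> chart_dom c p ->
    chart_derive c N p v = - A p (chart_derive c r p v).

Definition angle_function (R : realType) (M : Type) (N : M -> 'rV[R]_3)
    (k : 'rV[R]_3) (p : M) : R := angle (N p) k.

Definition tangent_part (R : realType) (M : Type) (N : M -> 'rV[R]_3)
    (k : 'rV[R]_3) (p : M) : 'rV[R]_3 :=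
  k - cos (angle_function N k p) *: N p.

Definition canonical_principal_direction (R : realType) (M : Type)
    (A : M -> 'rV[R]_3 -> 'rV[R]_3) (U : M -> 'rV[R]_3) : Prop :=
  exists kappa : M -> R,
    (forall p, A p (U p) = kappa p *: U p) /\ (forall p, kappa p != 0).

(* Points where some principal curvature vanishes, i.e. det A = 0. *)
Definition degenerate (R : realType) (M : topologicalType)
    (atlas : set (chart R M)) (r : M -> 'rV[R]_3)
    (A : M -> 'rV[R]_3 -> 'rV[R]_3) : set M :=
  [set p | exists X, [/\ tangent atlas r p X, X != 0 & A p X = 0]].

(* Complement of the topological boundary of the locus det A = 0.  A boundary
   point (e.g. over an inflection point of a horizontal section) lies neither
   in a patch of the first normal form, where det A <> 0, nor in a cylindrical
   patch, where det A = 0. *)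
Definition generic_locus (R : realType) (M : topologicalType)
    (atlas : set (chart R M)) (r : M -> 'rV[R]_3)
    (A : M -> 'rV[R]_3 -> 'rV[R]_3) : set M :=
  ~` degenerate atlas r A `|` (degenerate atlas r A)°.

(* The integral from a to b with the usual sign convention when b < a. *)
Definition oriented_integral (R : realType) (a b : R) (f : R -> R) : R :=
  if a <= b then \int[lebesgue_measure]_(t in `[a, b]) f t
  else - \int[lebesgue_measure]_(t in `[b, a]) f t.

Definition open_rectangle (R : realType) (a b c d : R) : set 'rV[R]_2 :=
  [set v | a < v 0 0 < b /\ c < v 0 1 < d].

Definition primitive_on (R : realType) (D : set R) (f F : R -> R) : Prop :=
  forall x, D x -> is_derive x (1 : R) F (f x).

Definition height (R : realType) (theta : R -> R) (x : R) : R :=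
  oriented_integral 0 x (fun t => sin (theta t)).

Definition case1_param (R : realType) (theta phi psi : R -> R) (x y : R) :
    'rV[R]_3 :=
  vec3
    (phi x * cos y - oriented_integral 0 y (fun t => psi t * sin t))
    (phi x * sin y + oriented_integral 0 y (fun t => psi t * cos t))
    (height theta x).

Definition case2_param (R : realType) (theta phi : R -> R) (y0 x y : R) :
    'rV[R]_3 :=
  vec3 (phi x * cos y0) (phi x * sin y0) (height theta x)
  + y *: vec3 (- sin y0) (cos y0) 0.

(* Near p, after an isometry F of E^3 taking the direction k to (0,0,1), the
   immersion is given in some coordinates (x,y) by one of the two normal
   forms.  The coordinates range over a rectangle containing (0,0), so that the
   integrals based at 0 only involve values inside it; the point p itself may
   have any coordinates. *)
Definition local_normal_form (R : realType) (M : topologicalType)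
    (atlas : set (chart R M)) (k : 'rV[R]_3) (r N : M -> 'rV[R]_3) (p : M) :
    Prop :=
  exists (xy : chart R M) (F : 'rV[R]_3 -> 'rV[R]_3) (a b c d : R)
      (theta phi : R -> R),
    [/\ local_coordinates atlas xy /\ chart_dom xy p,
        a < 0 < b /\ c < 0 < d,
        chart_cod xy = open_rectangle a b c d,
        euclidean_isometry F /\ (forall u, F (u + k) = F u + vec3 0 0 1) &
    [/\ smooth_on (`]a, b[ : set R) theta,
        (forall v, chart_cod xy v ->
           angle_function N k (chart_inv xy v) = theta (v 0 0)),
        primitive_on `]a, b[ (fun x => cos (theta x)) phi &
        (exists2 psi : R -> R, smooth_on (`]c, d[ : set R) psi &
           forall v, chart_cod xy v ->
             F (r (chart_inv xy v)) = case1_param theta phi psi (v 0 0) (v 0 1))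
        \/
        (exists y0 : R, forall v, chart_cod xy v ->
             F (r (chart_inv xy v)) = case2_param theta phi y0 (v 0 0) (v 0 1))]].

(* Main.v *)
Require Import Defs.
From HB Require Import structures.
From mathcomp Require Import all_boot all_order all_algebra.
From mathcomp Require Import all_classical all_reals all_analysis.
From mathcomp Require Import ring lra.

(** Let theta be the angle between the normal N and k, and U = k - cos theta N.
    If A U = kappa U, then self-adjointness of the shape operator A gives
    d(cos theta) = - kappa dh, where h is the height along k
    (normal_height_derive).  As dh does not vanish, theta is locally a function
    of h, so dh / sin theta is exact: it is dx for an arc length coordinate x
    along the integral curves of U (exists_arclength).  These curves lie in
    vertical planes, and theta and h depend on x alone.

    Take an orthonormal frame whose last vector is k and write the horizontal
    part of the normal as - sin theta e(y), with e(y) the unit vector of angle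
    y.  This y is the polar angle of the normal, and (theta, y) are spherical
    coordinates for the Gauss map.

    Where det A is nonzero the Gauss map is a local diffeomorphism, hence (x, y)
    are coordinates.  The derivative of the horizontal part of the immersion is
    cos theta(x) e(y) along x and orthogonal to e(y) along y.  Therefore the
    horizontal part is phi(x) e(y) + gamma(y) with gamma' = psi e'
    (patch_case1).

    Where det A vanishes identically, A kills a horizontal tangent vector.
    Since A is self-adjoint, y is stationary (polar_angle_stationary), hence
    constant.  The horizontal coordinate orthogonal to e(y) then completes x to
    a coordinate system, in which the surface is a cylinder (patch_case2).

    Outside the boundary of the closed set det A = 0 one of the two situations
    occurs near every point, and the complement of such a boundary is open and
    dense.

    The analysis rests on the inverse function theorem, proved here in n
    variables by the contraction principle, on the symmetry of second
    derivatives, and on a calculus of iterated directional derivatives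
    (smooth_onP and the lemmas on Ck). *)

Set Implicit Arguments.
Unset Strict Implicit.
Unset Printing Implicit Defensive.

Import Order.TTheory GRing.Theory Num.Theory.
Import numFieldNormedType.Exports.

Local Open Scope classical_set_scope.
Local Open Scope ring_scope.

(** * Derivatives of maps between normed spaces *)
Section derivative_rules.
Variables (R : realType) (V W : normedModType R).
Implicit Types (f g : V -> W) (D : set V).

(** The definition of differentiability refers to the chosen differential
    of f; an affine approximation found by estimates is enough. *)
Lemma differentiable_epsilon f x (L : {linear V -> W}) : continuous L ->
  (forall e, 0 < e -> \forall h \near 0, `|f (h + x) - f x - L h| <= e * `|h|) ->
  differentiable f x.
Proof.
move=> cL fL.
have fxL : f \o shift x = cst (f x) + L +o_ 0 id.
  apply/eqaddoP => e e0; near=> y.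
  have -> : (f \o shift x - (cst (f x) + L)) y = f (y + x) - f x - L y.
    by rewrite -addrA -opprD.
  by near: y; exact: fL.
by apply/diff_locallyP; rewrite (diff_unique cL fxL).
Unshelve. all: by end_near. Qed.

(** Differentiability depends only on the germ, because g - f vanishes near x
    and therefore has differential zero. *)
Lemma near_eq_differentiable f g x :
  (\near x, f x = g x) -> differentiable f x -> differentiable g x.
Proof.
move=> fg df.
have e0 : differentiable (g - f) x.
  apply: (@differentiable_epsilon _ _ (\0 : {linear V -> W})).
    by move=> y; exact: cst_continuous.
  move=> e e0; near=> y.
  rewrite !fctE (nbhs_singleton fg) subrr !subr0.
  suff -> : f (y + x) = g (y + x) by rewrite subrr normr0 mulr_ge0 // ltW.
  by near: y; move: fg; rewrite (near_shift 0) subr0; exact.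
by rewrite -[g](subrKC f); apply: differentiableD.
Unshelve. all: by end_near. Qed.

Lemma open_eq_differentiable D f g x : open D -> D x ->
  (forall y, D y -> f y = g y) -> differentiable f x -> differentiable g x.
Proof.
move=> oD Dx fg; apply: near_eq_differentiable.
by apply: filterS fg _; exact: open_nbhs_nbhs.
Qed.

Lemma open_eq_derive D f g x v : open D -> D x ->
  (forall y, D y -> f y = g y) -> 'D_v f x = 'D_v g x.
Proof.
move=> oD Dx fg; apply: near_eq_derive.
by apply: filterS fg _; exact: open_nbhs_nbhs.
Qed.

Lemma derive_linearP f x u v (a : R) : differentiable f x ->
  'D_(a *: u + v) f x = a *: 'D_u f x + 'D_v f x.
Proof. by move=> df; rewrite !deriveE // linearP. Qed.

Lemma derive_line f x v (t : R) : differentiable f (x + t *: v) ->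
  is_derive t 1 (fun s => f (x + s *: v)) ('D_v f (x + t *: v)).
Proof.
move=> df.
have dl : is_diff t (fun s : R => x + s *: v) (fun s => s *: v).
  have -> : (fun s : R => x + s *: v) = cst x + ( *:%R^~ v) by [].
  apply: (is_diff_eq (is_diffD (is_diff_cst x t) (is_diff_scalel t v))).
  by rewrite add0r.
have dc : is_diff t (fun s => f (x + s *: v))
    ('d f (x + t *: v) \o (fun s : R => s *: v)).
  exact: (@is_diff_comp _ _ _ _ _ _ _ _ _ dl (differentiableP df)).
apply: DeriveDef; first exact/diff_derivable/ex_diff.
by rewrite deriveE ?diff_val /= ?scale1r ?deriveE.
Qed.

End derivative_rules.

(** * Iterated differentiability *)

(** All directional derivatives of order at most n are differentiable on D; so
    rank 0 is differentiability.  The first derivative is taken innermost,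
    which lets the rules of calculus be proved by induction on n. *)
Fixpoint Ck (R : realType) (V W : normedModType R) (n : nat) (D : set V)
    (f : V -> W) : Prop :=
  (forall x, D x -> differentiable f x) /\
  if n is m.+1 then forall v, Ck m D ('D_v f) else True.

Section ck_theory.
Variables (R : realType) (V : normedModType R).
Implicit Types (W : normedModType R) (D : set V).

Lemma Ck_diff W n D (f : V -> W) x : Ck n D f -> D x -> differentiable f x.
Proof. by case: n => [|n] [+ _]; exact. Qed.

Lemma Ck_derive W n D (f : V -> W) v : Ck n.+1 D f -> Ck n D ('D_v f).
Proof. by case=> _; exact. Qed.

Lemma CkW W n D (f : V -> W) : Ck n.+1 D f -> Ck n D f.
Proof.
elim: n f => [|n IH] f; first by case=> df _; split.
by move=> [df Cf]; split=> // v; apply: IH; exact: Cf.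
Qed.

Lemma Ck_subset W n D D' (f : V -> W) : D' `<=` D -> Ck n D f -> Ck n D' f.
Proof.
move=> sD; elim: n f => [|n IH] f [df Cf].
  by split=> // x /sD; exact: df.
split=> [x /sD|v]; first exact: df.
by apply: IH; exact: Cf.
Qed.

Lemma Ck_eq W n D (f g : V -> W) : open D ->
  (forall x, D x -> f x = g x) -> Ck n D f -> Ck n D g.
Proof.
move=> oD; elim: n f g => [|n IH] f g fg [df Cf].
  by split=> // x Dx; apply: (open_eq_differentiable oD Dx fg); exact: df.
split=> [x Dx|v].
  by apply: (open_eq_differentiable oD Dx fg); exact: df.
apply: IH (Cf v) => x Dx; exact: open_eq_derive oD Dx fg.
Qed.

(** The two definitions peel a list of directions from opposite ends. *)
Lemma smooth_onP W D (f : V -> W) : smooth_on D f <-> forall n, Ck n D f.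
Proof.
split=> [sf n|Cf l x Dx].
  elim: n f sf => [|n IH] f sf; first by split=> // x Dx; exact: (sf [::]).
  split=> [x Dx|v]; first exact: (sf [::]).
  by apply: IH => l x Dx; have := sf (rcons l v) x Dx; rewrite foldr_rcons.
have {Cf} := Cf (size l); elim/last_ind: l f => [|l v IH] f.
  by move=> C0; exact: (Ck_diff C0).
by rewrite size_rcons foldr_rcons => C1; apply: IH; exact: Ck_derive.
Qed.

Lemma Ck_cst W n D (a : W) : Ck n D (cst a).
Proof.
elim: n a => [|n IH] a; split=> // v.
suff -> : 'D_v (cst a) = cst (0 : W) by exact: IH.
by apply/funext => x; exact: derive_cst.
Qed.

Lemma Ck_linear W n D (L : {linear V -> W}) : continuous L -> Ck n D L.
Proof.
move=> cL; have dL x : differentiable L x by exact: linear_differentiable.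
case: n => [|n]; split=> // v.
suff -> : 'D_v L = cst (L v) by exact: Ck_cst.
by apply/funext => x; rewrite deriveE // diff_lin.
Qed.

Lemma Ck_linear_comp W W' n D (L : {linear W -> W'}) (f : V -> W) :
  open D -> continuous L -> Ck n D f -> Ck n D (L \o f).
Proof.
move=> oD cL.
have dL g x : differentiable g x -> differentiable (L \o g) x.
  by move=> dg; apply: differentiable_comp => //; exact: linear_differentiable.
elim: n f => [|n IH] f [df Cf].
  by split=> // x Dx; apply: dL; exact: df.
split=> [x Dx|v]; first by apply: dL; exact: df.
apply: (Ck_eq oD) (IH _ (Cf v)) => x Dx /=.
rewrite !deriveE; [|exact: dL (df _ Dx)|exact: df].
rewrite (diff_comp (df _ Dx) (linear_differentiable _ cL)).
by rewrite /= diff_lin.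
Qed.

Lemma CkD W n D (f g : V -> W) : open D ->
  Ck n D f -> Ck n D g -> Ck n D (f \+ g).
Proof.
move=> oD; elim: n f g => [|n IH] f g [df Cf] [dg Cg].
  by split=> // x Dx; apply: differentiableD; [exact: df|exact: dg].
split=> [x Dx|v]; first by apply: differentiableD; [exact: df|exact: dg].
apply: (Ck_eq oD) (IH _ _ (Cf v) (Cg v)) => x Dx /=.
by rewrite -deriveD //; apply: diff_derivable; [exact: df|exact: dg].
Qed.

Lemma Ck_sum W n D (I : Type) (r : seq I) (F : I -> V -> W) : open D ->
  (forall i, Ck n D (F i)) -> Ck n D (fun x => \sum_(i <- r) F i x).
Proof.
move=> oD CF; elim: r => [|i r IH].
  by apply: (Ck_eq oD _ (Ck_cst n D 0)) => x _; rewrite big_nil.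
apply: (Ck_eq oD _ (CkD oD (CF i) IH)) => x _; by rewrite big_cons.
Qed.

Lemma CkM n D (f g : V -> R) : open D ->
  Ck n D f -> Ck n D g -> Ck n D (fun x => f x * g x).
Proof.
move=> oD; elim: n f g => [|n IH] f g Cf Cg.
  split=> // x Dx; apply: differentiableM; [exact: Ck_diff Cf _|exact: Ck_diff Cg _].
split=> [x Dx|v].
  apply: differentiableM; [exact: Ck_diff Cf _|exact: Ck_diff Cg _].
have C1 := IH _ _ (CkW Cf) (Ck_derive v Cg).
have C2 := IH _ _ (CkW Cg) (Ck_derive v Cf).
apply: (Ck_eq oD) (CkD oD C1 C2) => x Dx /=.
rewrite [RHS](deriveM (f := f) (g := g)) //; apply: diff_derivable;
  [exact: Ck_diff Cf _|exact: Ck_diff Cg _].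
Qed.

Lemma CkN n D (f : V -> R) : open D -> Ck n D f -> Ck n D (fun x => - f x).
Proof.
move=> oD Cf; apply: (Ck_eq oD _ (CkM oD (Ck_cst n D (-1 : R)) Cf)) => x _ /=.
by rewrite mulN1r.
Qed.

Lemma Ck_prod n D (I : Type) (r : seq I) (F : I -> V -> R) : open D ->
  (forall i, Ck n D (F i)) -> Ck n D (fun x => \prod_(i <- r) F i x).
Proof.
move=> oD CF; elim: r => [|i r IH].
  by apply: (Ck_eq oD _ (Ck_cst n D (1 : R))) => x _; rewrite big_nil.
apply: (Ck_eq oD _ (CkM oD (CF i) IH)) => x _; by rewrite big_cons.
Qed.

Lemma CkV n D (f : V -> R) : open D -> (forall x, D x -> f x != 0) ->
  Ck n D f -> Ck n D (fun x => (f x)^-1).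
Proof.
move=> oD f0; elim: n => [|n IH] Cf.
  by split=> // x Dx; apply: differentiableV; [exact: Ck_diff Cf _|exact: f0].
split=> [x Dx|v].
  by apply: differentiableV; [exact: Ck_diff Cf _|exact: f0].
have CV := IH (CkW Cf).
apply: (Ck_eq oD) (CkM oD (CkN oD (CkM oD CV CV)) (Ck_derive v Cf)) => x Dx /=.
rewrite deriveV ?f0 //; last by apply: diff_derivable; exact: Ck_diff Cf _.
by rewrite -exprVn.
Qed.

End ck_theory.

Section ck_coordinates.
Variables (R : realType) (V : normedModType R).
Implicit Types (W : normedModType R) (D : set V).

Lemma derive_comp W W' (f : W -> W') (g : V -> W) x v :
  differentiable g x -> differentiable f (g x) ->
  'D_v (f \o g) x = 'D_('D_v g x) f (g x).
Proof.
move=> dg df; have dfg := differentiable_comp dg df.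
by rewrite !deriveE // (diff_comp dg df).
Qed.

Lemma derive_coord n (f : V -> 'rV[R]_n) x v j : differentiable f x ->
  'D_v f x 0 j = 'D_v (fun y => f y 0 j) x.
Proof. by move=> df; rewrite derive_mx ?mxE //; exact: diff_derivable. Qed.

Lemma differentiable_entry n (f : V -> 'rV[R]_n) x j : differentiable f x ->
  differentiable (fun y => f y 0 j) x.
Proof.
move=> df; apply: (differentiable_comp (g := fun N : 'rV[R]_n => N 0 j) df).
exact: (differentiable_coord _ 0 j).
Qed.

Lemma coord_linear n (j : 'I_n) : exists2 L : {linear 'rV[R]_n -> R},
  continuous L & L = (fun v => v 0 j) :> ('rV[R]_n -> R).
Proof.
have lin : linear (fun v : 'rV[R]_n => v 0 j).
  by move=> a u v; rewrite !mxE.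
pose L0 := GRing.isLinear.Build _ _ _ _ _ lin.
pose L : {linear 'rV[R]_n -> R} := HB.pack (fun v : 'rV[R]_n => v 0 j) L0.
exists L => //; exact: coord_continuous.
Qed.

Lemma Ck_coord n k D (f : V -> 'rV[R]_n) j : open D ->
  Ck k D f -> Ck k D (fun x => f x 0 j).
Proof.
move=> oD Cf; have [L cL Lj] := coord_linear j.
have -> : (fun x => f x 0 j) = L \o f by rewrite Lj.
exact: Ck_linear_comp.
Qed.

Lemma Ck_scalel W k D (f : V -> R) (w : W) : open D ->
  Ck k D f -> Ck k D (fun x => f x *: w).
Proof.
move=> oD Cf.
have lin : linear ( *:%R ^~ w : R -> W) by move=> a x y; rewrite scalerDl scalerA.
pose L0 := GRing.isLinear.Build _ _ _ _ _ lin.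
pose L : {linear R -> W} := HB.pack ( *:%R^~ w) L0.
by apply: (Ck_linear_comp (L := L) oD _ Cf); exact: scalel_continuous.
Qed.

Lemma Ck_row n k D (f : V -> 'rV[R]_n) : open D ->
  (forall j, Ck k D (fun x => f x 0 j)) -> Ck k D f.
Proof.
move=> oD Cf.
have -> : f = fun x => \sum_j f x 0 j *: delta_mx 0 j.
  by apply/funext => x; exact: row_sum_delta.
by apply: Ck_sum => // j; exact: Ck_scalel.
Qed.

Lemma derive_partials W n (f : 'rV[R]_n -> W) x v : differentiable f x ->
  'D_v f x = \sum_j v 0 j *: 'D_(delta_mx 0 j) f x.
Proof.
move=> df; rewrite deriveE // {1}[v]row_sum_delta linear_sum.
by apply: eq_bigr => j _; rewrite linearZ deriveE.
Qed.

End ck_coordinates.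

Section ck_composition.
Variables (R : realType) (V : normedModType R).
Implicit Types D : set V.

(** The derivatives of f \o g are sums of products of derivatives of g with
    partial derivatives of f composed with g, to which induction applies. *)
Lemma Ck_comp_scalar n k D (E : set 'rV[R]_n) (g : V -> 'rV[R]_n)
    (f : 'rV[R]_n -> R) : open D -> (forall x, D x -> E (g x)) ->
  Ck k D g -> Ck k E f -> Ck k D (f \o g).
Proof.
move=> oD gD; elim: k f => [|k IH] f Cg Cf.
  split=> // x Dx; apply: differentiable_comp; first exact: Ck_diff Cg _.
  by apply: (Ck_diff Cf); exact: gD.
have dg x : D x -> differentiable g x := fun Dx => Ck_diff Cg Dx.
have df x : D x -> differentiable f (g x) := fun Dx => Ck_diff Cf (gD _ Dx).
split=> [x Dx|v]; first by apply: differentiable_comp; [exact: dg|exact: df].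
pose h j x := 'D_v g x 0 j * ('D_(delta_mx 0 j) f \o g) x.
have Ch : Ck k D (fun x => \sum_j h j x).
  apply: Ck_sum => // j; apply: CkM => //.
    by apply: Ck_coord => //; exact: Ck_derive.
  by apply: IH; [exact: CkW|exact: Ck_derive].
apply: (Ck_eq oD _ Ch) => x Dx.
by rewrite (derive_comp _ (dg _ Dx) (df _ Dx)) derive_partials //; exact: df.
Qed.

Lemma Ck_comp_row n m k D (E : set 'rV[R]_n) (g : V -> 'rV[R]_n)
    (f : 'rV[R]_n -> 'rV[R]_m) :
  open D -> open E -> (forall x, D x -> E (g x)) ->
  Ck k D g -> Ck k E f -> Ck k D (f \o g).
Proof.
move=> oD oE gD Cg Cf; apply: Ck_row => // j.
exact: (Ck_comp_scalar (f := fun y => f y 0 j) oD gD Cg (Ck_coord j oE Cf)).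
Qed.

Lemma Ck_comp_real k D (I : set R) (f : R -> R) (g : V -> R) :
  open D -> (forall x, D x -> I (g x)) ->
  Ck k D g -> Ck k I f -> Ck k D (f \o g).
Proof.
move=> oD gD; elim: k f => [|k IH] f Cg Cf.
  split=> // x Dx; apply: differentiable_comp; first exact: Ck_diff Cg _.
  by apply: (Ck_diff Cf); exact: gD.
have dg x : D x -> differentiable g x := fun Dx => Ck_diff Cg Dx.
have df x : D x -> differentiable f (g x) := fun Dx => Ck_diff Cf (gD _ Dx).
split=> [x Dx|v]; first by apply: differentiable_comp; [exact: dg|exact: df].
have Ch := CkM oD (Ck_derive v Cg) (IH _ (CkW Cg) (Ck_derive (1 : R) Cf)).
apply: (Ck_eq oD _ Ch) => x Dx /=.
rewrite (derive_comp _ (dg _ Dx) (df _ Dx)) !(deriveE _ (df _ Dx)).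
by rewrite -[in RHS](mulr1 ('D_v g x)) [RHS]linearZ.
Qed.

End ck_composition.

Lemma open_preimage_on (R : realType) (V : normedModType R) (D : set V)
    (f : V -> R) (I : set R) :
  open D -> Ck 0 D f -> open I -> open (D `&` f @^-1` I).
Proof.
move=> oD Cf oI; rewrite openE => x [Dx Ix]; rewrite /interior.
apply: filterI; first exact: open_nbhs_nbhs.
apply: (differentiable_continuous (Ck_diff Cf Dx)).
exact: open_nbhs_nbhs.
Qed.

(** * Mean values and the symmetry of second derivatives *)
Section mean_value.
Variables (R : realType) (V : normedModType R).
Implicit Types (D : set V) (f : V -> R).

Lemma mean_value_segment f x v :
  (forall t : R, 0 <= t <= 1 -> differentiable f (x + t *: v)) ->
  exists2 t : R, 0 < t < 1 & f (x + v) - f x = 'D_v f (x + t *: v).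
Proof.
move=> df; pose h (t : R) := f (x + t *: v).
have dh (t : R) : 0 <= t <= 1 -> is_derive t 1 h ('D_v f (x + t *: v)).
  by move=> /df; exact: derive_line.
have [|t t01||t t01 eq] := @MVT _ h (fun t => 'D_v f (x + t *: v)) 0 1.
- exact: ltr01.
- by apply: dh; move: t01; rewrite in_itv /= => /andP[/ltW -> /ltW ->].
- apply: derivable_within_continuous => t; rewrite in_itv /= => /dh.
  by case.
- exists t; first by move: t01; rewrite in_itv.
  by move: eq; rewrite subr0 mulr1 /h scale1r scale0r addr0.
Qed.

Lemma ball_segment (c x v : V) (r t : R) : 0 <= t <= 1 ->
  ball c r x -> ball c r (x + v) -> ball c r (x + t *: v).
Proof.
move=> /andP[t0 t1]; rewrite -!ball_normE /ball_ /= => bx bv.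
have -> : c - (x + t *: v) = (1 - t) *: (c - x) + t *: (c - (x + v)).
  have -> : c - (x + v) = (c - x) - v by rewrite opprD addrA.
  by rewrite scalerBl scale1r [t *: (c - x - v)]scalerBr addrA subrK opprD addrA.
rewrite (le_lt_trans (ler_normD _ _)) // !normrZ !ger0_norm ?subr_ge0 //.
have [->|t0'] := eqVneq t 0; first by rewrite subr0 mul1r mul0r addr0.
have tp : 0 < t by rewrite lt_neqAle eq_sym t0'.
have -> : r = (1 - t) * r + t * r by ring.
by rewrite ler_ltD // ?ler_wpM2l ?subr_ge0 // ?ltW // ltr_pM2l.
Qed.

Lemma derive0_ball_const f (c x v : V) r :
  (forall y, ball c r y -> differentiable f y) ->
  (forall y, ball c r y -> 'D_v f y = 0) ->
  ball c r x -> ball c r (x + v) -> f (x + v) = f x.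
Proof.
move=> df f0 bx bv.
have [t t01|t t01 eq] := @mean_value_segment f x v.
  by apply: df; exact: ball_segment.
apply/eqP; rewrite -subr_eq0 eq f0 //; apply: ball_segment => //.
by case/andP: t01 => /ltW -> /ltW ->.
Qed.

(** The mean value theorem is used twice: along v for the increment of f over
    w, then along w for the derivative of f in the direction v. *)
Lemma second_difference D f x v w : open D -> Ck 1 D f ->
  (forall a b : R, 0 <= a <= 1 -> 0 <= b <= 1 -> D (x + a *: v + b *: w)) ->
  exists a b : R, [/\ 0 < a < 1, 0 < b < 1 &
    f (x + v + w) - f (x + v) - (f (x + w) - f x) =
    'D_w ('D_v f) (x + a *: v + b *: w)].
Proof.
move=> oD Cf Dx.
have i01 (t : R) : 0 < t < 1 -> 0 <= t <= 1 by move=> /andP[/ltW -> /ltW ->].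
have z01 : 0 <= (0 : R) <= 1 by rewrite ?lexx ?ler01.
have o01 : 0 <= (1 : R) <= 1 by rewrite ?lexx ?ler01.
have Dxa (a : R) : 0 <= a <= 1 -> D (x + a *: v).
  by move=> a01; have := Dx a 0 a01 z01; rewrite scale0r addr0.
have Dxw (a : R) : 0 <= a <= 1 -> D (x + a *: v + w).
  by move=> a01; have := Dx a 1 a01 o01; rewrite scale1r.
pose F z := f (z + w) - f z.
have dsh z : is_diff z (shift w : V -> V) id.
  have -> : shift w = id + cst w :> (V -> V) by [].
  by apply: (is_diff_eq (is_diffD (is_diff_id z) (is_diff_cst w z))); rewrite addr0.
have dfw z : D (z + w) -> differentiable (f \o shift w) z.
  move=> Dz; apply: differentiable_comp; first exact: ex_diff.
  exact: Ck_diff Cf Dz.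
have DF z : D z -> D (z + w) -> 'D_v F z = 'D_v f (z + w) - 'D_v f z.
  move=> Dz Dzw; have -> : F = (f \o shift w) - f by [].
  have df := Ck_diff Cf Dz.
  rewrite deriveB; [|exact/diff_derivable/dfw|exact/diff_derivable].
  congr (_ - _); rewrite derive_comp; [|exact: ex_diff|exact: Ck_diff Cf Dzw].
  have -> : 'D_v (shift w) z = v by rewrite deriveE ?diff_val //; exact: ex_diff.
  by [].
have [t t01|a a01 eqa] := @mean_value_segment F x v.
  apply: (@differentiableB _ _ _ (f \o shift w) f).
    by apply: dfw; exact: Dxw.
  by apply: Ck_diff Cf _; exact: Dxa.
have [t t01|b b01 eqb] := @mean_value_segment ('D_v f) (x + a *: v) w.
  by apply: (Ck_diff (Ck_derive v Cf)); apply: Dx => //; exact: i01.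
exists a, b; split=> //.
by move: eqa; rewrite DF; [rewrite eqb|exact/Dxa/i01|exact/Dxw/i01].
Qed.

(** Second differences over t v and t w are symmetric in v and w; divided by
    t ^ 2 they come close to both mixed derivatives when t is small. *)
Lemma derive_sym D f x v w : open D -> Ck 2 D f -> D x ->
  'D_w ('D_v f) x = 'D_v ('D_w f) x.
Proof.
move=> oD Cf Dx.
have [A AE] : exists A : V -> V -> V -> R,
    forall v w y, 'D_w ('D_v f) y = A v w y.
  by exists (fun v w => 'D_w ('D_v f)).
rewrite !AE.
have cA v' w' : {for x, continuous (A v' w')}.
  have -> : A v' w' = 'D_w' ('D_v' f) by apply/funext => y; rewrite AE.
  apply: differentiable_continuous.
  by apply: Ck_diff Dx; exact: Ck_derive (Ck_derive v' Cf).
have hom (t : R) v' w' y : D y -> A (t *: v') (t *: w') y = t ^+ 2 * A v' w' y.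
  move=> Dy; rewrite -!AE.
  have -> : 'D_(t *: w') ('D_(t *: v') f) y = 'D_(t *: w') (t *: 'D_v' f) y.
    apply: (open_eq_derive _ oD Dy) => z Dz; have df := Ck_diff Cf Dz.
    by rewrite -[t *: v']addr0 derive_linearP // derive0 addr0.
  have d1 : differentiable ('D_v' f) y := Ck_diff (Ck_derive v' Cf) Dy.
  rewrite -[t *: w']addr0 derive_linearP; last exact: differentiableZ.
  by rewrite derive0 addr0 deriveZ ?expr2 -?mulrA //; exact: diff_derivable.
apply/eqP; rewrite -subr_eq0 -normr_le0; apply/ler_addgt0Pr => e e0.
rewrite add0r.
have e2 : 0 < e / 2 by rewrite divr_gt0.
have /nbhs_ballP[r /= r0 Br] : \forall y \near x,
    [/\ D y, `|A v w x - A v w y| < e / 2 & `|A w v x - A w v y| < e / 2].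
  have nD : nbhs x D by exact: open_nbhs_nbhs.
  have /cvgrPdist_lt/(_ _ e2) n1 := cA v w.
  have /cvgrPdist_lt/(_ _ e2) n2 := cA w v.
  by apply: filterS3 nD n1 n2 => y.
have [t t0 tr] : exists2 t : R, 0 < t & t * (`|v| + `|w|) < r.
  have M0 : 0 < `|v| + `|w| + 1 by rewrite ltr_wpDl.
  exists (r / (`|v| + `|w| + 1)); first by rewrite divr_gt0.
  by rewrite mulrAC ltr_pdivrMr // ltr_pM2l // ltrDl.
have inB a b v' w' : `|v'| + `|w'| = `|v| + `|w| ->
    0 <= a <= 1 -> 0 <= b <= 1 -> ball x r (x + a *: (t *: v') + b *: (t *: w')).
  move=> Evw /andP[a0 a1] /andP[b0 b1]; rewrite -ball_normE /ball_ /=.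
  rewrite -addrA opprD addrA subrr add0r normrN.
  apply: (@le_lt_trans _ _ (t * (`|v'| + `|w'|))).
    rewrite (le_trans (ler_normD _ _)) // !normrZ mulrDr.
    rewrite (ger0_norm a0) (ger0_norm b0) (ger0_norm (ltW t0)).
    by rewrite lerD // ler_piMl // mulr_ge0 // ltW.
  by rewrite Evw.
have [a [b [a01 b01 eq1]]] := @second_difference D f x (t *: v) (t *: w) oD
  (CkW Cf) (fun a b ha hb => let: And3 h _ _ := Br _ (inB a b v w erefl ha hb) in h).
have [a' [b' [a01' b01' eq2]]] := @second_difference D f x (t *: w) (t *: v) oD
  (CkW Cf) (fun a b ha hb =>
    let: And3 h _ _ := Br _ (inB a b w v (addrC _ _) ha hb) in h).
have i01 (s : R) : 0 < s < 1 -> 0 <= s <= 1 by move=> /andP[/ltW -> /ltW ->].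
have [D1 B1 _] := Br _ (inB _ _ v w erefl (i01 _ a01) (i01 _ b01)).
have [D2 _ B2] := Br _ (inB _ _ w v (addrC _ _) (i01 _ a01') (i01 _ b01')).
move: eq1 eq2; rewrite !AE !hom // => eq1 eq2.
have E : t ^+ 2 * A v w (x + a *: (t *: v) + b *: (t *: w)) =
    t ^+ 2 * A w v (x + a' *: (t *: w) + b' *: (t *: v)).
  rewrite -eq1 -eq2 [x + t *: w + t *: v]addrAC; ring.
have {}E : A v w (x + a *: (t *: v) + b *: (t *: w)) =
    A w v (x + a' *: (t *: w) + b' *: (t *: v)).
  by apply: (mulfI _ E); rewrite expf_neq0 // gt_eqF.
rewrite -[_ - _](subrKA (A v w (x + a *: (t *: v) + b *: (t *: w)))).
rewrite (le_trans (ler_normD _ _)) // [leRHS]splitr lerD ?ltW //.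
by rewrite E distrC.
Qed.

End mean_value.

(** * The inverse function theorem *)
Lemma Ck_id (R : realType) (W : normedModType R) k (D : set W) :
  Ck k D (id : W -> W).
Proof. by apply: (@Ck_linear _ _ _ _ _ idfun) => x; exact: cvg_id. Qed.

Lemma derive_linear_comp (R : realType) (V W W' : normedModType R)
    (L : {linear W -> W'}) (f : V -> W) x v :
  continuous L -> differentiable f x -> 'D_v (L \o f) x = L ('D_v f x).
Proof.
move=> cL df; rewrite derive_comp //; last exact: linear_differentiable.
by rewrite deriveE ?diff_lin //; exact: linear_differentiable.
Qed.

Lemma Ck_det (R : realType) m k (V : normedModType R) (D : set V) (M : V -> 'M[R]_m) :
  open D -> (forall i j, Ck k D (fun x => M x i j)) ->
  Ck k D (fun x => \det (M x)).
Proof.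
move=> oD CM; apply: (Ck_sum _ oD) => s; apply: CkM => //; first exact: Ck_cst.
by apply: Ck_prod => // i; exact: CM.
Qed.

Section finite_dimension.
Variables (R : realType) (n : nat).
Implicit Types (W : normedModType R) (v : 'rV[R]_n).

Lemma rV_norm_coord v j : `|v 0 j| <= `|v|.
Proof. by rewrite [leRHS]/Num.Def.normr /= mx_normrE (le_bigmax _ _ (0, j)). Qed.

Lemma rV_norm_le v (c : R) : 0 <= c -> (forall j, `|v 0 j| <= c) -> `|v| <= c.
Proof.
move=> c0 vc; rewrite [leLHS]/Num.Def.normr /= mx_normrE (bigmax_le _ c0) //=.
by move=> -[i j] _; rewrite ord1.
Qed.

(** A linear map is a combination of coordinate functions. *)
Lemma linear_rV_continuous W (L : {linear 'rV[R]_n -> W}) : continuous L.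
Proof.
have -> : (L : 'rV[R]_n -> W) = fun v => \sum_j v 0 j *: L (delta_mx 0 j).
  apply/funext => v; rewrite {1}[v]row_sum_delta linear_sum.
  by apply: eq_bigr => j _; rewrite linearZ.
move=> v; apply: differentiable_continuous; apply: (@Ck_diff _ _ _ 0 setT) => //.
apply: (Ck_sum _ openT) => j; apply: (Ck_scalel _ openT).
by apply: (Ck_coord j openT); exact: Ck_id.
Qed.

End finite_dimension.

Section near_identity.
Variables (R : realType) (n : nat).
Implicit Types q y : 'rV[R]_n.

(** The Banach fixed point argument: a map which differs from the identity by
    a contraction is open, since T q = y means that q is fixed by
    q |-> q - T q + y. *)
Lemma near_identity_surjective (T : 'rV[R]_n -> 'rV[R]_n) q0 (r : R) : 0 < r ->
  (forall q q', ball q0 r q -> ball q0 r q' ->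
     `|T q' - T q - (q' - q)| <= 2^-1 * `|q' - q|) ->
  forall y, `|y - T q0| < r / 4 -> exists2 q, ball q0 r q & T q = y.
Proof.
move=> r0 Tr y yr.
pose U := closed_ball q0 (r / 2).
have UE q : U q <-> `|q0 - q| <= r / 2.
  by rewrite /U closed_ballE ?divr_gt0.
have UB q : U q -> ball q0 r q.
  move=> /UE qr; rewrite -ball_normE /ball_ /= (le_lt_trans qr) //.
  by rewrite ltr_pdivrMr // ltr_pMr // ltr1n.
have Uq0 : U q0 by apply/UE; rewrite subrr normr0 divr_ge0 // ltW.
pose F q := q - T q + y.
have FF q q' : F q - F q' = T q' - T q - (q' - q).
  by apply/rowP => j; rewrite /F !mxE; ring.
have FU q : U q -> U (F q).
  move=> Uq; apply/UE.
  have -> : q0 - F q = (T q - T q0 - (q - q0)) - (y - T q0).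
    by apply/rowP => j; rewrite /F !mxE; ring.
  rewrite (le_trans (ler_normB _ _)) //.
  have h1 := Tr _ _ (UB _ Uq0) (UB _ Uq); have /UE h2 := Uq.
  by rewrite distrC in h2; lra.
have Ufun : set_fun U U F by move=> q /=; exact: FU.
pose Fm := isFun.Build _ _ U U F Ufun.
pose FF0 : {fun U >-> U} := HB.pack F Fm.
have ctr : is_contraction FF0.
  have h2 : 0 <= 2^-1 :> R by [].
  exists (NngNum h2); split => /=; first by rewrite invf_lt1 // ltr1n.
  move=> [q q'] [/= Uq Uq']; rewrite FF (distrC q q').
  by apply: Tr; exact: UB.
pose X : completeNormedModType R := HB.pack 'rV[R]_n.
have [|q Uq Eq] := @banach_fixed_point R X U FF0 ctr _ (ex_intro _ q0 Uq0).
  exact: closed_ball_closed.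
exists q; first exact: UB.
have : q = F q by [].
by rewrite /F => E; apply/rowP => j; move/rowP/(_ j): E; rewrite !mxE => E; lra.
Qed.

Lemma near_identity_injective (T : 'rV[R]_n -> 'rV[R]_n) q0 (r : R) :
  (forall q q', ball q0 r q -> ball q0 r q' ->
     `|T q' - T q - (q' - q)| <= 2^-1 * `|q' - q|) ->
  forall q q', ball q0 r q -> ball q0 r q' -> `|q' - q| <= 2 * `|T q' - T q|.
Proof.
move=> Tr q q' Bq Bq'.
have h1 := Tr _ _ Bq Bq'.
have : `|q' - q| <= `|T q' - T q| + `|T q' - T q - (q' - q)|.
  have {1}-> : q' - q = (T q' - T q) - (T q' - T q - (q' - q)).
    by apply/rowP => j; rewrite !mxE; ring.
  exact: ler_normB.
lra.
Qed.

End near_identity.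

Section inverse_function.
Variables (R : realType) (n : nat).
Implicit Types (q v y : 'rV[R]_n) (V : set 'rV[R]_n).

Lemma mulmx_norm_le m (K : 'M[R]_(n, m)) :
  exists2 C, 0 < C & forall v, `|v *m K| <= C * `|v|.
Proof.
have := @linear_lipschitz _ _ _ (mulmxr K : {linear 'rV[R]_n -> 'rV[R]_m}).
by apply; exact: linear_rV_continuous.
Qed.

Lemma Ck_mulmxr k (W : normedModType R) (D : set W) (f : W -> 'rV[R]_n) m
  (K : 'M[R]_(n, m)) : open D -> Ck k D f -> Ck k D (fun x => f x *m K).
Proof.
move=> oD; apply: (Ck_linear_comp (L := mulmxr K) oD).
exact: linear_rV_continuous.
Qed.

(** By linearity it suffices to control the n partial derivatives, which are
    continuous; K plays the part of the inverse of the derivative at q0. *)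
Lemma derivative_near_constant (Phi : 'rV[R]_n -> 'rV[R]_n) V q0 K :
  open V -> V q0 -> Ck 1 V Phi -> (forall v, 'D_v Phi q0 *m K = v) ->
  exists r, [/\ 0 < r, ball q0 r `<=` V &
    forall q v, ball q0 r q -> `|'D_v Phi q *m K - v| <= 2^-1 * `|v|].
Proof.
move=> oV Vq0 CPhi PhiK.
pose E (i : 'I_n) q := 'D_(delta_mx 0 i) Phi q *m K - delta_mx 0 i.
(* n partial derivatives contribute; n.+1 keeps e positive when n = 0 *)
pose e : R := (2 * n.+1%:R)^-1.
have e0 : 0 < e by rewrite invr_gt0 mulr_gt0.
have nE : \forall q \near q0, forall i : 'I_n, `|E i q| < e.
  apply: (@filter_forall _ _ (fun (i : 'I_n) q => `|E i q| < e) (nbhs q0)) => i.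
  have CE : Ck 0 V (E i).
    have C1 := Ck_mulmxr K oV (Ck_derive (delta_mx 0 i) CPhi).
    exact: (CkD oV C1 (@Ck_cst _ _ 'rV[R]_n 0 V (- delta_mx 0 i))).
  have /differentiable_continuous/cvgrPdist_lt/(_ _ e0) := Ck_diff CE Vq0.
  by apply: filterS => q; rewrite {1}/E PhiK subrr sub0r normrN.
have nV : nbhs q0 V by exact: open_nbhs_nbhs.
have [r /= r0 Br] := (@nbhs_ballP R 'rV[R]_n q0 _).1 (filterI nV nE).
exists r; split=> // [q /Br[]//|q v /Br[Vq Eq]].
have -> : 'D_v Phi q *m K - v = \sum_i v 0 i *: E i q.
  rewrite derive_partials; last exact: Ck_diff CPhi Vq.
  rewrite {2}[v]row_sum_delta mulmx_suml -sumrB.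
  by apply: eq_bigr => i _; rewrite /E scalerBr scalemxAl.
rewrite (le_trans (ler_norm_sum _ _ _)) //.
apply: (@le_trans _ _ (\sum_(i < n) `|v| * e)).
  apply: ler_sum => i _; rewrite normrZ ler_pM //; first exact: rV_norm_coord.
  by rewrite ltW // Eq.
rewrite sumr_const card_ord -[leLHS]mulr_natr -mulrA mulrC ler_wpM2r //.
rewrite /e invfM -mulrA ler_piMr // ler_pdivrMl // mulr1 ler_nat //.
Qed.

(** The mean value theorem for each entry of Phi K - id. *)
Lemma derivative_near_constant_contraction (Phi : 'rV[R]_n -> 'rV[R]_n) q0 K r :
  (forall q, ball q0 r q -> differentiable Phi q) ->
  (forall q v, ball q0 r q -> `|'D_v Phi q *m K - v| <= 2^-1 * `|v|) ->
  forall q q', ball q0 r q -> ball q0 r q' ->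
    `|Phi q' *m K - Phi q *m K - (q' - q)| <= 2^-1 * `|q' - q|.
Proof.
move=> dPhi PhiK q q' Bq Bq'; apply: rV_norm_le => [|j].
  by rewrite mulr_ge0.
pose L : {linear 'rV[R]_n -> 'rV[R]_n} := mulmxr K.
have cL : continuous L by exact: linear_rV_continuous.
pose h z := (L \o Phi) z - z.
have dLP z : ball q0 r z -> differentiable (L \o Phi) z.
  move=> /dPhi dz; apply: differentiable_comp => //.
  exact: linear_differentiable.
have dh z : ball q0 r z -> differentiable h z.
  by move=> /dLP dz; exact: (differentiableB (g := id) dz).
have dhj z : ball q0 r z -> differentiable (fun z => h z 0 j) z.
  by move=> /dh; exact: differentiable_entry.
have seg (t : R) : 0 <= t <= 1 -> ball q0 r (q + t *: (q' - q)).
  by move=> t01; apply: ball_segment => //; rewrite subrKC.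
have [t /seg/dhj//|t /andP[/ltW t0 /ltW t1]] :=
  @mean_value_segment _ _ (fun z => h z 0 j) q (q' - q).
have Bt : ball q0 r (q + t *: (q' - q)) by apply: seg; rewrite t0.
rewrite subrKC -derive_coord; last exact: dh.
have -> : 'D_(q' - q) h (q + t *: (q' - q)) =
    'D_(q' - q) Phi (q + t *: (q' - q)) *m K - (q' - q).
  rewrite deriveB; [|exact/diff_derivable/dLP|exact: derivable_id].
  by rewrite derive_linear_comp ?derive_id //; exact: dPhi.
have -> : h q' 0 j - h q 0 j =
    (Phi q' *m K - Phi q *m K - (q' - q)) 0 j.
  by rewrite /h /= /L /= !mxE; ring.
by move=> ->; rewrite (le_trans (rV_norm_coord _ _)) // PhiK.
Qed.

(** A right inverse that is Lipschitz is differentiable wherever the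
    derivative J of the map at the target is invertible: if k is the increment
    of the inverse over h, then h = k J + o(k), hence k = h J^-1 + o(h). *)
Lemma lipschitz_right_inverse_differentiable
    (Phi g : 'rV[R]_n -> 'rV[R]_n) (B : set 'rV[R]_n) y (C : R) :
  open B -> B y -> 0 < C ->
  (forall z, B z -> Phi (g z) = z) ->
  (forall z, B z -> `|g z - g y| <= C * `|z - y|) ->
  differentiable Phi (g y) -> 'J Phi (g y) \in unitmx ->
  differentiable g y.
Proof.
move=> oB By C0 Phig gL dPhi uJ; set J := 'J Phi (g y) in uJ.
have [D D0 KD] := mulmx_norm_le (invmx J).
apply: (@differentiable_epsilon _ _ _ _ _ (mulmxr (invmx J))).
  exact: linear_rV_continuous.
move=> e e0.
have e'0 : 0 < e / (C * D) by rewrite divr_gt0 // mulr_gt0.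
have /(_ _ e'0) : forall eps : R, 0 < eps -> \forall k \near (0 : 'rV[R]_n),
    `|Phi (k + g y) - Phi (g y) - k *m J| <= eps * `|k|.
  move=> eps eps0; have [_ /eqaddoP/(_ _ eps0)] := (diff_locallyP _ _).1 dPhi.
  by apply: filterS => k; rewrite /J mul_rV_lin1 -[X in _ -> `|X| <= _]addrA -opprD.
move=> /(@nbhs_ballP R 'rV[R]_n)[eta /= eta0 Beta].
have nB : nbhs y B by exact: open_nbhs_nbhs.
have /(@nbhs_ballP R 'rV[R]_n)[rho /= rho0 Brho] := nB.
apply/(@nbhs_ballP R 'rV[R]_n); exists (Num.min rho (eta / C)).
  by rewrite /= lt_min rho0 divr_gt0.
move=> h; rewrite -ball_normE /ball_ /= sub0r normrN lt_min => /andP[hrho heta].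
have Bh : B (h + y).
  by apply: Brho; rewrite -ball_normE /ball_ /= opprD addrC subrK normrN.
have Lh := gL _ Bh; rewrite addrK in Lh.
set k := g (h + y) - g y in Lh *.
have bk : ball (0 : 'rV[R]_n) eta k.
  rewrite -ball_normE /ball_ /= sub0r normrN (le_lt_trans Lh) //.
  by rewrite mulrC -ltr_pdivlMr.
have := Beta _ bk; rewrite /= /k subrK !Phig // addrK -/k => hk.
have -> : k - h *m invmx J = - ((h - k *m J) *m invmx J).
  by rewrite mulmxBl mulmxK // opprB.
rewrite normrN (le_trans (KD _)) // (le_trans (ler_wpM2l (ltW D0) hk)) //.
have -> : D * (e / (C * D) * `|k|) = e / C * `|k|.
  by rewrite invfM; field; rewrite !gt_eqF.
have eC : 0 <= e / C by rewrite divr_ge0 // ltW.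
by rewrite (le_trans (ler_wpM2l eC Lh)) // mulrA divfK // gt_eqF.
Qed.

(** By Cramer's rule the derivative of an inverse map is a rational expression
    in the derivative of the map, so each order of differentiability of the
    inverse gives the next one. *)
Lemma right_inverse_smooth (Phi g : 'rV[R]_n -> 'rV[R]_n)
    (U B : set 'rV[R]_n) :
  open U -> open B -> (forall k, Ck k U Phi) ->
  (forall y, B y -> U (g y)) -> (forall y, B y -> Phi (g y) = y) ->
  (forall y, B y -> differentiable g y) ->
  (forall y, B y -> 'J Phi (g y) \in unitmx) ->
  smooth_on B g.
Proof.
move=> oU oB CPhi gU Phig dg uJ; apply/smooth_onP.
elim=> [|k IH]; first by [].
split=> // v.
pose J y := 'J Phi (g y).
have dPhi y : B y -> differentiable Phi (g y).
  by move=> By; exact: Ck_diff (CPhi 0%N) (gU _ By).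
have CJ i j : Ck k B (fun y => J y i j).
  have C1 := Ck_comp_row oB oU gU IH (Ck_derive (delta_mx 0 i) (CPhi k.+1)).
  apply: (Ck_eq oB _ (Ck_coord j oB C1)) => y By /=.
  by rewrite (deriveEjacobian _ (dPhi _ By)) -rowE mxE.
pose d y := (\det (J y))^-1.
have Cd : Ck k B d.
  apply: CkV => //; last exact: Ck_det.
  by move=> y /uJ; rewrite unitmxE unitfE.
have Dg y : B y -> 'D_v g y = v *m invmx (J y).
  move=> By; have /(congr1 (mulmx^~ (invmx (J y)))) : v = 'D_v g y *m J y.
    rewrite -(deriveEjacobian _ (dPhi _ By)) -(derive_comp _ (dg _ By) (dPhi _ By)).
    rewrite -[LHS](derive_id y v); apply: (open_eq_derive _ oB By) => z Bz.
    by rewrite /= Phig.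
  by rewrite mulmxK ?uJ // => ->.
apply: (Ck_eq oB _ (_ : Ck k B (fun y => \row_j
    \sum_i v 0 i * (d y * cofactor (J y) j i)))).
  move=> y By; rewrite Dg //; apply/rowP => j; rewrite !mxE.
  by apply: eq_bigr => i _; rewrite /invmx uJ // !mxE.
apply: Ck_row => // j.
apply: (Ck_eq oB (f := fun y => \sum_i v 0 i * (d y * cofactor (J y) j i))).
  by move=> y _; rewrite mxE.
apply: Ck_sum => // i; apply: CkM => //; first exact: Ck_cst.
apply: CkM => //; apply: CkM => //; first exact: Ck_cst.
apply: Ck_det => // i' j'.
by apply: (Ck_eq oB _ (CJ (lift j i') (lift i j'))) => y _; rewrite !mxE.
Qed.

(** If K is the inverse of the derivative of Phi at q0, then Phi K differs from
    the identity by a contraction on a small ball.  Hence it is injective and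
    open there, its inverse is Lipschitz, and the two preceding lemmas make the
    inverse differentiable and then smooth. *)
Theorem inverse_function (Phi : 'rV[R]_n -> 'rV[R]_n) V q0 :
  open V -> V q0 -> smooth_on V Phi -> (forall v, 'D_v Phi q0 = 0 -> v = 0) ->
  exists (U : set 'rV[R]_n) (d : R) (g : 'rV[R]_n -> 'rV[R]_n),
    [/\ open U, U q0, U `<=` V, 0 < d &
    [/\ forall q, U q -> ball (Phi q0) d (Phi q) -> g (Phi q) = q,
        forall y, ball (Phi q0) d y -> U (g y),
        forall y, ball (Phi q0) d y -> Phi (g y) = y &
        smooth_on (ball (Phi q0) d) g]].
Proof.
move=> oV Vq0 /smooth_onP CPhi inj.
have dPhi q : V q -> differentiable Phi q := Ck_diff (CPhi 0%N).
have uJ0 : 'J Phi q0 \in unitmx.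
  rewrite -row_free_unit; apply: inj_row_free => v.
  by rewrite -deriveEjacobian; [exact: inj|exact: dPhi].
set K := invmx ('J Phi q0).
have [r [r0 BV near1]] : exists r, [/\ 0 < r, ball q0 r `<=` V &
    forall q v, ball q0 r q -> `|'D_v Phi q *m K - v| <= 2^-1 * `|v|].
  apply: derivative_near_constant => // v.
  by rewrite deriveEjacobian ?mulmxK //; exact: dPhi.
have contr := derivative_near_constant_contraction
  (fun q Bq => dPhi q (BV _ Bq)) near1.
have injT := near_identity_injective contr.
have surT := near_identity_surjective r0 contr.
have [C C0 KC] := mulmx_norm_le K.
have [d d0 dC] : exists2 d, 0 < d & C * d = r / 4.
  by exists (r / 4 / C); [rewrite !divr_gt0|rewrite mulrC divfK // gt_eqF].
have ex y : exists q, ball (Phi q0) d y -> ball q0 r q /\ Phi q = y.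
  have [By|nBy] := pselect (ball (Phi q0) d y); last by exists 0.
  have [|q Bq Tq] := surT (y *m K).
    rewrite -mulmxBl (le_lt_trans (KC _)) // -dC ltr_pM2l //.
    by rewrite distrC; move: By; rewrite -ball_normE.
  exists q => _; split=> //.
  by rewrite -[Phi q](mulmxKV uJ0) -/K Tq mulmxKV.
have [g gP] := choice ex.
have gB y : ball (Phi q0) d y -> ball q0 r (g y) by move=> /gP[].
have Phig y : ball (Phi q0) d y -> Phi (g y) = y by move=> /gP[].
have injP q q' : ball q0 r q -> ball q0 r q' ->
    `|q' - q| <= 2 * C * `|Phi q' - Phi q|.
  move=> Bq Bq'; rewrite (le_trans (injT _ _ Bq Bq')) // -mulmxBl -mulrA.
  by rewrite ler_pM2l // KC.
have uJ q : ball q0 r q -> 'J Phi q \in unitmx.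
  move=> Bq; rewrite -row_free_unit; apply: inj_row_free => v.
  rewrite -deriveEjacobian; last exact/dPhi/BV.
  move=> Dv; have := near1 _ v Bq; rewrite Dv mul0mx sub0r normrN.
  move=> hv; apply/eqP; rewrite -normr_le0; lra.
exists (ball q0 r), d, g; split=> //; first exact: ball_open.
  exact: ballxx.
have oB : open (ball (Phi q0) d) by exact: ball_open.
split=> // [q Bq Bq'|].
  have := injP _ _ Bq (gB _ Bq'); rewrite Phig // subrr normr0 mulr0.
  by rewrite normr_le0 subr_eq0 => /eqP.
have dg y : ball (Phi q0) d y -> differentiable g y.
  move=> By.
  apply: (lipschitz_right_inverse_differentiable (C := 2 * C) oB By _ Phig).
  - by rewrite mulr_gt0.
  - move=> z Bz; rewrite -{2}(Phig z Bz) -{2}(Phig y By).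
    by apply: injP; exact: gB.
  - exact/dPhi/BV/gB.
  - exact/uJ/gB.
have oBr : open (ball q0 r) by exact: ball_open.
exact: (right_inverse_smooth oBr oB (fun k => Ck_subset BV (CPhi k)) gB Phig dg
  (fun y By => uJ _ (gB _ By))).
Qed.

End inverse_function.

(** * Integrals and primitives of continuous functions *)
Section integration.
Variable R : realType.

Lemma continuous_within_segment (f : R -> R) (a b : R) :
  (forall x : R, a <= x <= b -> {for x, continuous f}) ->
  {within `[a, b], continuous f}.
Proof.
move=> cf; apply: continuous_in_subspaceT => x; rewrite inE /= in_itv /=.
exact: cf.
Qed.

Lemma Rintegral_derivative (f F : R -> R) (a b : R) : a <= b ->
  (forall x : R, a <= x <= b -> is_derive x (1 : R) F (f x)) ->
  (forall x : R, a <= x <= b -> {for x, continuous f}) ->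
  (\int[lebesgue_measure]_(t in `[a, b]) f t)%R = F b - F a.
Proof.
rewrite le_eqVlt => /orP[/eqP <-|ab] dF cf.
  by rewrite set_itv1 Rintegral_set1 subrr.
have cF (x : R) : a <= x <= b -> {for x, continuous F}.
  move=> /dF[dx _]; apply: differentiable_continuous.
  exact/derivable1_diffP.
rewrite /Rintegral (@continuous_FTC2 _ f F) //.
- exact: continuous_within_segment.
- split.
  + move=> x; rewrite in_itv /= => /andP[/ltW ax /ltW xb].
    by have [] := dF x; rewrite ?ax.
  + by apply: cvg_at_right_filter; apply: cF; rewrite lexx ltW.
  + by apply: cvg_at_left_filter; apply: cF; rewrite lexx ltW.
- move=> x; rewrite in_itv /= => /andP[/ltW ax /ltW xb].
  by have [|_ <-] := dF x; rewrite ?ax // derive1E.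
Qed.

Lemma oriented_integral_derivative (f F : R -> R) (c d y : R) : c < 0 -> 0 < d ->
  (forall x : R, c < x < d -> is_derive x (1 : R) F (f x)) ->
  (forall x : R, c < x < d -> {for x, continuous f}) ->
  c < y < d -> oriented_integral 0 y f = F y - F 0.
Proof.
move=> c0 d0 dF cf /andP[cy yd]; rewrite /oriented_integral.
have cd (a b x : R) : c < a -> b < d -> a <= x <= b -> c < x < d.
  by move=> ca bd /andP[ax xb]; rewrite (lt_le_trans ca) // (le_lt_trans xb).
case: ifPn => [y0|].
  by apply: Rintegral_derivative => // x xy; [apply: dF|apply: cf];
    exact: cd c0 yd xy.
rewrite -ltNge -[RHS]opprB => /ltW y0; congr (- _).
by apply: Rintegral_derivative => // x xy; [apply: dF|apply: cf];
  exact: cd cy d0 xy.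
Qed.

(** The primitive is an integral based at - d / 2, which is inside the interval
    of continuity; hence the loss of half of the interval. *)
Lemma exists_primitive (f : R -> R) (d : R) : 0 < d ->
  (forall x : R, - d < x < d -> {for x, continuous f}) ->
  exists F : R -> R, forall x : R, - (d / 2) < x < d / 2 ->
    is_derive x (1 : R) F (f x).
Proof.
move=> d0 cf.
pose F (x : R) := (\int[lebesgue_measure]_(t in `[(- (d / 2)), x]) f t)%R.
exists F => x /andP[xl xu].
have int : lebesgue_measure.-integrable `[(- (d / 2)), d / 2] (EFin \o f).
  apply: continuous_compact_integrable; first exact: segment_compact.
  by apply: continuous_within_segment => t /andP[tl tu]; apply: cf; lra.
have [|dF <-] := continuous_FTC1_closed xu int xl.
  by apply: cf; lra.
by rewrite derive1E; exact: derivableP.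
Qed.

End integration.

(** * Smoothness of trigonometric functions *)
Section elementary_functions.
Variable R : realType.
Implicit Types (I : set R) (k : nat).

Lemma Ck_primitive k I (f f' : R -> R) : open I ->
  (forall x, I x -> is_derive x (1 : R) f (f' x)) -> Ck k I f' -> Ck k.+1 I f.
Proof.
move=> oI df Cf'.
have dif x : I x -> differentiable f x.
  by move=> /df[d _]; exact/derivable1_diffP.
split=> // v.
apply: (Ck_eq oI _ (CkM oI (@Ck_cst _ _ R k I v) Cf')) => x Ix /=.
have [_ <-] := df _ Ix.
have := derive_linearP (1 : R) 0 v (dif _ Ix).
by rewrite addr0 derive0 addr0 [v *: (1 : R)]mulr1 => ->.
Qed.

Lemma Ck_sin_cos k : Ck k [set: R] sin /\ Ck k [set: R] cos.
Proof.
elim: k => [|k [IHs IHc]].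
  by split; split=> // x _; exact/derivable1_diffP.
split; first by apply: (Ck_primitive openT _ IHc) => x _; exact: is_derive_sin.
apply: (Ck_primitive openT _ (CkN openT IHs)) => x _; exact: is_derive_cos.
Qed.

Lemma Ck_sin k I : Ck k I (@sin R).
Proof. exact: Ck_subset (@subsetT _ _) (Ck_sin_cos k).1. Qed.

Lemma Ck_cos k I : Ck k I (@cos R).
Proof. exact: Ck_subset (@subsetT _ _) (Ck_sin_cos k).2. Qed.

Lemma sin_acos_gt0 (x : R) : -1 < x < 1 -> 0 < sin (acos x).
Proof.
move=> /andP[x0 x1]; rewrite sin_acos ?ltW // sqrtr_gt0; nra.
Qed.

(** The derivative of acos is - 1 / sin (acos x), so smoothness of acos
    propagates without any recourse to square roots. *)
Lemma Ck_acos k : Ck k (`]-1, 1[%classic : set R) (@acos R).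
Proof.
have oI : open (`]-1, 1[%classic : set R) by exact: interval_open.
have iI (x : R) : (`]-1, 1[%classic : set R) x -> -1 < x < 1 by rewrite /= in_itv.
elim: k => [|k IH].
  by split=> // x /iI /is_derive1_acos[d _]; exact/derivable1_diffP.
have Cs : Ck k (`]-1, 1[%classic : set R) (sin \o @acos R).
  by apply: (Ck_comp_real (I := setT)) => //; exact: Ck_sin.
apply: (Ck_primitive oI _ (CkN oI (CkV oI _ Cs))) => x /iI xI /=; last first.
  by rewrite gt_eqF // sin_acos_gt0.
rewrite sin_acos; last by case/andP: xI => /ltW -> /ltW ->.
exact: is_derive1_acos.
Qed.

Lemma Ck_atan k I : Ck k I (@atan R).
Proof.
apply: Ck_subset (@subsetT _ I) _.
have Cd j : Ck j setT (fun x : R => (1 + x ^+ 2)^-1).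
  apply: CkV => [|x _|]; first exact: openT.
    by rewrite gt_eqF // ltr_wpDr // sqr_ge0.
  have C1 := CkM openT (Ck_id j setT) (Ck_id j (setT : set R)).
  exact: (CkD openT (@Ck_cst _ _ R j setT 1) C1).
case: k => [|k].
  by split=> // x _; have [d _] := is_derive1_atan x; exact/derivable1_diffP.
by apply: (Ck_primitive openT _ (Cd k)) => x _; exact: is_derive1_atan.
Qed.

End elementary_functions.

(** * Coordinates in the plane *)
Section plane_coordinates.
Variable R : realType.
Implicit Types (z v : 'rV[R]_2) (h : 'rV[R]_2 -> R).

Definition vec2 (a b : R) : 'rV[R]_2 := \row_(i < 2) [:: a; b]`_i.

Definition dx : 'rV[R]_2 := vec2 1 0.
Definition dy : 'rV[R]_2 := vec2 0 1.

Lemma vec2_0 a b : vec2 a b 0 0 = a. Proof. by rewrite mxE. Qed.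
Lemma vec2_1 a b : vec2 a b 0 1 = b. Proof. by rewrite mxE. Qed.

Lemma ord2P (j : 'I_2) : j = 0 \/ j = 1.
Proof. by case: j => [[|[|m]] mlt] //; [left|right]; exact: val_inj. Qed.

Lemma rV2P z v : z 0 0 = v 0 0 -> z 0 1 = v 0 1 -> z = v.
Proof.
move=> h0 h1; apply/rowP => j.
by have [->|->] := ord2P j.
Qed.

Lemma vec2E z : z = vec2 (z 0 0) (z 0 1).
Proof. by apply: rV2P; rewrite ?vec2_0 ?vec2_1. Qed.

Lemma in_ball2 (d : R) z :
  ball (0 : 'rV[R]_2) d z <-> - d < z 0 0 < d /\ - d < z 0 1 < d.
Proof.
rewrite -ball_normE /ball_ /= sub0r normrN; split=> [zd|[z0 z1]].
  by rewrite -!ltr_norml; split; rewrite (le_lt_trans (rV_norm_coord _ _)).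
have d0 : 0 < d by case/andP: z0 => ? ?; lra.
rewrite [ltLHS]/Num.Def.normr /= mx_normrE bigmax_lt //= => -[i j] _.
rewrite ord1 ltr_norml.
by have [->|->] := ord2P j.
Qed.

Lemma ball2_slice (d x y : R) : - d < x < d -> - d < y < d ->
  ball (0 : 'rV[R]_2) d (vec2 x y).
Proof. by move=> xd yd; apply/in_ball2; rewrite vec2_0 vec2_1. Qed.

Section slices.
Variables (h : 'rV[R]_2 -> R) (d : R).
Hypothesis dh : forall z, ball 0 d z -> differentiable h z.

Lemma const_along_y : (forall z, ball 0 d z -> 'D_dy h z = 0) ->
  forall z, ball 0 d z -> h z = h (vec2 (z 0 0) 0).
Proof.
move=> h0 z Bz; have [z0 z1] := (in_ball2 _ _).1 Bz.
have zE : z = vec2 (z 0 0) 0 + z 0 1 *: dy.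
  by apply: rV2P; rewrite !mxE /=; ring.
have B0 : ball 0 d (vec2 (z 0 0) 0) by apply: ball2_slice => //; lra.
rewrite {1}zE; apply: (@derive0_ball_const _ _ h 0 _ _ d) => //.
  move=> y By; have := derive_linearP dy 0 (z 0 1) (dh By).
  by rewrite addr0 derive0 addr0 h0 // scaler0.
by rewrite -zE.
Qed.

Lemma derive_slice_x (x y : R) : ball 0 d (vec2 x y) ->
  is_derive x (1 : R) (fun t => h (vec2 t y)) ('D_dx h (vec2 x y)).
Proof.
move=> B.
have E (t : R) : vec2 t y = vec2 0 y + t *: dx.
  by apply: rV2P; rewrite !mxE /=; ring.
have -> : (fun t => h (vec2 t y)) = (fun t => h (vec2 0 y + t *: dx)).
  by apply/funext => t; rewrite E.
have D : differentiable h (vec2 0 y + x *: dx) by rewrite -E; exact: dh.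
by rewrite (E x); exact: (derive_line D).
Qed.

Lemma derive_slice_y (x y : R) : ball 0 d (vec2 x y) ->
  is_derive y (1 : R) (fun t => h (vec2 x t)) ('D_dy h (vec2 x y)).
Proof.
move=> B.
have E (t : R) : vec2 x t = vec2 x 0 + t *: dy.
  by apply: rV2P; rewrite !mxE /=; ring.
have -> : (fun t => h (vec2 x t)) = (fun t => h (vec2 x 0 + t *: dy)).
  by apply/funext => t; rewrite E.
have D : differentiable h (vec2 x 0 + y *: dy) by rewrite -E; exact: dh.
by rewrite (E y); exact: (derive_line D).
Qed.

End slices.

Lemma Ck_slice_x k h (d : R) : Ck k (ball 0 d) h -> 0 < d ->
  Ck k (`]- d, d[%classic : set R) (fun t => h (vec2 t 0)).
Proof.
move=> Ch d0.
have oI : open (`]- d, d[%classic : set R) by exact: interval_open.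
apply: (Ck_comp_scalar (E := ball 0 d) (f := h) oI _ _ Ch).
  by move=> t /=; rewrite in_itv /= => td; apply: ball2_slice => //; lra.
apply: Ck_row => // j; have [->|->] := ord2P j.
  by apply: (Ck_eq oI _ (Ck_id _ _)) => x _; rewrite vec2_0.
by apply: (Ck_eq oI _ (Ck_cst _ _ (0 : R))) => x _; rewrite vec2_1.
Qed.

Lemma Ck_slice_y k h (d : R) : Ck k (ball 0 d) h -> 0 < d ->
  Ck k (`]- d, d[%classic : set R) (fun t => h (vec2 0 t)).
Proof.
move=> Ch d0.
have oI : open (`]- d, d[%classic : set R) by exact: interval_open.
apply: (Ck_comp_scalar (E := ball 0 d) (f := h) oI _ _ Ch).
  by move=> t /=; rewrite in_itv /= => td; apply: ball2_slice => //; lra.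
apply: Ck_row => // j; have [->|->] := ord2P j.
  by apply: (Ck_eq oI _ (Ck_cst _ _ (0 : R))) => x _; rewrite vec2_0.
by apply: (Ck_eq oI _ (Ck_id _ _)) => x _; rewrite vec2_1.
Qed.

(** The chart is centred at q0 and its image is a square, where the vanishing of
    a partial derivative means independence of that coordinate. *)
Lemma coordinates_from_functions (V : set 'rV[R]_2) (X Y : 'rV[R]_2 -> R) q0 :
  open V -> V q0 -> (forall k, Ck k V X) -> (forall k, Ck k V Y) ->
  X q0 = 0 -> Y q0 = 0 ->
  (forall v, 'D_v X q0 = 0 -> 'D_v Y q0 = 0 -> v = 0) ->
  exists (U : set 'rV[R]_2) (d : R) (g : 'rV[R]_2 -> 'rV[R]_2),
    [/\ open U, U q0, U `<=` V, 0 < d &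
    [/\ forall q, U q -> ball 0 d (vec2 (X q) (Y q)) ->
          g (vec2 (X q) (Y q)) = q,
        forall z, ball 0 d z -> U (g z),
        forall z, ball 0 d z -> X (g z) = z 0 0,
        forall z, ball 0 d z -> Y (g z) = z 0 1 &
        forall k, Ck k (ball 0 d) g]].
Proof.
move=> oV Vq CX CY X0 Y0 inj.
pose Phi q := vec2 (X q) (Y q).
have CPhi k : Ck k V Phi.
  apply: Ck_row => // j.
  have [->|->] := ord2P j.
  - by apply: (Ck_eq oV _ (CX k)) => q _; rewrite vec2_0.
  - by apply: (Ck_eq oV _ (CY k)) => q _; rewrite vec2_1.
have Phi0 : Phi q0 = 0 by apply: rV2P; rewrite /Phi X0 Y0 !mxE.
have dPhi : differentiable Phi q0 := Ck_diff (CPhi 0%N) Vq.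
have := @inverse_function R 2 Phi V q0 oV Vq ((smooth_onP _ _).2 CPhi).
case=> [v Dv|U [d [g [oU Uq UV d0 [gK gU Kg sg]]]]].
  apply: inj.
    have := derive_coord v 0 dPhi; rewrite Dv mxE => ->.
    by congr ('D_v _ q0); apply/funext => q; rewrite vec2_0.
  have := derive_coord v 1 dPhi; rewrite Dv mxE => ->.
  by congr ('D_v _ q0); apply/funext => q; rewrite vec2_1.
rewrite Phi0 in gK gU Kg sg; exists U, d, g; split=> //; split=> //.
- by move=> z Bz; rewrite -{2}(Kg _ Bz) vec2_0.
- by move=> z Bz; rewrite -{2}(Kg _ Bz) vec2_1.
- exact/smooth_onP.
Qed.

End plane_coordinates.

Arguments dx {R}.
Arguments dy {R}.

(** * Vectors of Euclidean space *)
Section space_vectors.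
Variable R : realType.
Implicit Types u v w : 'rV[R]_3.

Lemma ord3P (j : 'I_3) : [\/ j = 0, j = 1 | j = 2].
Proof.
by case: j => [[|[|[|m]]] mlt] //; [constructor 1|constructor 2|constructor 3];
   exact: val_inj.
Qed.

Lemma rV3P u v : u 0 0 = v 0 0 -> u 0 1 = v 0 1 -> u 0 2 = v 0 2 -> u = v.
Proof. by move=> h0 h1 h2; apply/rowP => j; have [->|->|->] := ord3P j. Qed.

Lemma dotE u v :
  dot u v = u 0 0 * v 0 0 + u 0 1 * v 0 1 + u 0 2 * v 0 2.
Proof.
rewrite /dot !big_ord_recl big_ord0 addr0 addrA.
by congr (_ * _ + _ * _ + _ * _); congr (_ _ _); exact: val_inj.
Qed.

Lemma vec3_0 a b c : (vec3 a b c : 'rV[R]_3) 0 0 = a. Proof. by rewrite mxE. Qed.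
Lemma vec3_1 a b c : (vec3 a b c : 'rV[R]_3) 0 1 = b. Proof. by rewrite mxE. Qed.
Lemma vec3_2 a b c : (vec3 a b c : 'rV[R]_3) 0 2 = c. Proof. by rewrite mxE. Qed.

Lemma dotC u v : dot u v = dot v u.
Proof. by rewrite !dotE; ring. Qed.

Lemma dotDl u v w : dot (u + v) w = dot u w + dot v w.
Proof. by rewrite !dotE !mxE; ring. Qed.

Lemma dotZl a u v : dot (a *: u) v = a * dot u v.
Proof. by rewrite !dotE !mxE; ring. Qed.

Lemma dotNl u v : dot (- u) v = - dot u v.
Proof. by rewrite !dotE !mxE; ring. Qed.

Lemma dotBl u v w : dot (u - v) w = dot u w - dot v w.
Proof. by rewrite dotDl dotNl. Qed.

Lemma dotDr u v w : dot w (u + v) = dot w u + dot w v.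
Proof. by rewrite dotC dotDl !(dotC w). Qed.

Lemma dotZr a u v : dot v (a *: u) = a * dot v u.
Proof. by rewrite dotC dotZl dotC. Qed.

Lemma dotBr u v w : dot w (u - v) = dot w u - dot w v.
Proof. by rewrite dotC dotBl !(dotC w). Qed.

Lemma dot0l u : dot 0 u = 0.
Proof. by rewrite !dotE !mxE; ring. Qed.

Lemma dot_ge0 u : 0 <= dot u u.
Proof. by rewrite dotE; nra. Qed.

Lemma dot_eq0 u : dot u u = 0 -> u = 0.
Proof.
rewrite dotE => h; apply: rV3P; rewrite mxE; apply/eqP; rewrite -sqrf_eq0;
  apply/eqP; nra.
Qed.

Lemma enorm1_dot u : enorm u = 1 -> dot u u = 1.
Proof.
by move=> h; rewrite -[dot u u]sqr_sqrtr ?dot_ge0 // -/(enorm u) h expr1n.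
Qed.

Lemma derive_dot (V : normedModType R) (a b : V -> 'rV[R]_3) (x v : V) :
  differentiable a x -> differentiable b x ->
  'D_v (fun y => dot (a y) (b y)) x = dot ('D_v a x) (b x) + dot (a x) ('D_v b x).
Proof.
move=> da db.
have dc (c : V -> 'rV[R]_3) j : differentiable c x ->
    differentiable (fun y => c y 0 j) x by exact: differentiable_entry.
have -> : (fun y => dot (a y) (b y)) =
    \sum_(i < 3) (fun y => a y 0 i * b y 0 i).
  by apply/funext => y; rewrite fct_sumE.
rewrite derive_sum => [|i]; last first.
  by apply: derivableM; apply: diff_derivable; exact: dc.
rewrite /dot -big_split /=; apply: eq_bigr => i _.
rewrite !derive_coord //.
rewrite (deriveM (f := fun y => a y 0 i) (g := fun y => b y 0 i));
  try by apply: diff_derivable; exact: dc.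
by rewrite addrC; congr (_ + _); rewrite [LHS]mulrC.
Qed.

Lemma derive_sym_row n (V : normedModType R) D (f : V -> 'rV[R]_n) (x v w : V) :
  open D -> Ck 2 D f -> D x -> 'D_w ('D_v f) x = 'D_v ('D_w f) x.
Proof.
move=> oD Cf Dx; apply/rowP => j.
have C1 (u : V) : Ck 1 D ('D_u f) by exact: Ck_derive.
have dD (u : V) : differentiable ('D_u f) x := Ck_diff (C1 u) Dx.
have E (u y : V) : D y -> 'D_u f y 0 j = 'D_u (fun z => f z 0 j) y.
  by move=> Dy; rewrite (derive_coord u j (Ck_diff Cf Dy)).
have sw (u u' : V) :
    'D_u' ('D_u f) x 0 j = 'D_u' ('D_u (fun z => f z 0 j)) x.
  transitivity ('D_u' (fun y => 'D_u f y 0 j) x).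
    exact: (derive_coord u' j (dD u)).
  exact: (open_eq_derive u' oD Dx (E u)).
transitivity ('D_w ('D_v (fun z => f z 0 j)) x); first exact: sw.
transitivity ('D_v ('D_w (fun z => f z 0 j)) x); last exact/esym/sw.
exact: (derive_sym v w oD (Ck_coord j oD Cf) Dx).
Qed.

End space_vectors.

(** * Parametrized surfaces with a canonical principal direction *)
Section surface_patch.
Variables (R : realType) (V : set 'rV[R]_2) (f n : 'rV[R]_2 -> 'rV[R]_3).
Hypotheses (oV : open V) (Cf : forall k, Ck k V f) (Cn : forall k, Ck k V n).
Hypothesis n_unit : forall q, V q -> dot (n q) (n q) = 1.
Hypothesis n_normal : forall q v, V q -> dot (n q) ('D_v f q) = 0.
Implicit Types q v w u : 'rV[R]_2.

Notation e3 := (vec3 0 0 1 : 'rV[R]_3).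

Let dif_f q : V q -> differentiable f q.
Proof. exact: Ck_diff (Cf 0%N). Qed.

Let dif_n q : V q -> differentiable n q.
Proof. exact: Ck_diff (Cn 0%N). Qed.

Lemma normal_derive_normal q v : V q -> dot (n q) ('D_v n q) = 0.
Proof.
move=> Vq; have dn := dif_n Vq.
have : 'D_v (fun y => dot (n y) (n y)) q = 0.
  rewrite -(derive_cst (1 : R) q v).
  by apply: (open_eq_derive v oV Vq) => y Vy; rewrite n_unit.
by rewrite derive_dot // dotC => h; lra.
Qed.

(** Self-adjointness of the shape operator: differentiate the orthogonality of
    the normal to the tangent plane and use the symmetry of second
    derivatives. *)
Lemma shape_symmetric q v w : V q ->
  dot ('D_v n q) ('D_w f q) = dot ('D_w n q) ('D_v f q).
Proof.
move=> Vq; have dn := dif_n Vq.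
have key u u' : dot ('D_u n q) ('D_u' f q) = - dot (n q) ('D_u ('D_u' f) q).
  have dDf : differentiable ('D_u' f) q := Ck_diff (Ck_derive u' (Cf 1%N)) Vq.
  have : 'D_u (fun y => dot (n y) ('D_u' f y)) q = 0.
    rewrite -(derive_cst (0 : R) q u).
    by apply: (open_eq_derive u oV Vq) => y Vy; rewrite n_normal.
  by rewrite (derive_dot u dn dDf) => /eqP; rewrite addr_eq0 => /eqP.
transitivity (- dot (n q) ('D_v ('D_w f) q)); first exact: key.
transitivity (- dot (n q) ('D_w ('D_v f) q)); last exact/esym/key.
by rewrite (derive_sym_row w v oV (Cf 2%N) Vq).
Qed.

(** The principal direction condition at q for the distinguished direction e3,
    read in the parameter plane of the immersion f with unit normal n: the
    vector u is mapped to the tangential part of the vertical direction, along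
    which the normal varies with a nonzero rate. *)
Definition vertical_principal q u (kappa : R) : Prop :=
  [/\ kappa != 0, 'D_u f q = e3 - n q 0 2 *: n q &
      'D_u n q = - (kappa *: 'D_u f q)].

Hypothesis princ : forall q, V q -> exists u kappa, vertical_principal q u kappa.
Hypothesis slope : forall q, V q -> -1 < n q 0 2 < 1.

Lemma dot_e3 (w : 'rV[R]_3) : dot e3 w = w 0 2.
Proof. by rewrite dotE vec3_0 vec3_1 vec3_2; ring. Qed.

Lemma vertical_derive q u (kappa : R) : V q -> vertical_principal q u kappa ->
  'D_u f q 0 2 = 1 - n q 0 2 ^+ 2.
Proof. by move=> _ [_ -> _]; rewrite !mxE /=; ring. Qed.

(** Because the tangential part of the vertical direction is principal, the
    angle between the normal and the vertical varies only with the height. *)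
Lemma normal_height_derive q : V q ->
  exists2 kappa : R, kappa != 0 &
    forall v, 'D_v n q 0 2 = - (kappa * 'D_v f q 0 2).
Proof.
move=> Vq; have [u [kappa [k0 Uf Un]]] := princ Vq.
exists kappa => // v.
have := shape_symmetric v u Vq.
rewrite Un dotNl dotZl {1}Uf Uf dotBr dotZr dotBl dotZl n_normal //.
rewrite (dotC _ (n q)) normal_derive_normal // dot_e3 (dotC _ e3) dot_e3.
by rewrite !mulr0 !subr0.
Qed.

Definition sin_angle q : R := sin (acos (n q 0 2)).

Let sin_angle_gt0 q : V q -> 0 < sin_angle q.
Proof. by move=> /slope; exact: sin_acos_gt0. Qed.

Let sin_angle_sqr q : V q -> sin_angle q ^+ 2 = 1 - n q 0 2 ^+ 2.
Proof.
move=> /slope /andP[h1 h2]; rewrite /sin_angle sin2cos2 acosK //.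
by rewrite in_itv /= !ltW.
Qed.

Let Ck_angle k : Ck k V (fun q => acos (n q 0 2)).
Proof.
apply: (Ck_comp_real (I := `]-1, 1[%classic) (g := fun q => n q 0 2) oV).
- by move=> q /slope; rewrite /= in_itv.
- exact: Ck_coord.
- exact: Ck_acos.
Qed.

Let Ck_sin_angle k : Ck k V sin_angle.
Proof.
apply: (Ck_comp_real (I := setT) (g := fun q => acos (n q 0 2)) oV) => //.
exact: Ck_sin.
Qed.

(** The angle is a function of the height, so d f3 / sin theta is an exact
    form; its primitive X is the arc length along the curves tangent to the
    principal direction. *)
Lemma exists_arclength (Y : 'rV[R]_2 -> R) q0 : V q0 -> (forall k, Ck k V Y) ->
  Y q0 = 0 -> f q0 0 2 = 0 ->
  (forall v, 'D_v f q0 0 2 = 0 -> 'D_v Y q0 = 0 -> v = 0) ->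
  exists (W : set 'rV[R]_2) (X : 'rV[R]_2 -> R),
    [/\ open W, W q0, W `<=` V, X q0 = 0 &
    [/\ forall k, Ck k W X &
        forall q v, W q -> 'D_v X q = 'D_v f q 0 2 * (sin_angle q)^-1]].
Proof.
move=> Vq0 CY Y0 f0 inj.
pose h q := f q 0 2; pose m q := n q 0 2.
have Ch k : Ck k V h by exact: Ck_coord.
have Cm k : Ck k V m by exact: Ck_coord.
have Dh q v : V q -> 'D_v h q = 'D_v f q 0 2.
  by move=> Vq; rewrite (derive_coord v 2 (dif_f Vq)).
have Dm q v : V q -> 'D_v m q = 'D_v n q 0 2.
  by move=> Vq; rewrite (derive_coord v 2 (dif_n Vq)).
have [v hv|U [d [g [oU Uq0 UV d0 [gK gU hg Yg Cg]]]]] :=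
  coordinates_from_functions oV Vq0 Ch CY f0 Y0.
  by apply: inj; rewrite -Dh.
have oB : open (ball (0 : 'rV[R]_2) d) by exact: ball_open.
have dg z : ball 0 d z -> differentiable g z := Ck_diff (Cg 0%N).
have gV z : ball 0 d z -> V (g z) by move=> /gU/UV.
have dhg z : ball 0 d z -> differentiable h (g z).
  by move=> /gV; exact: Ck_diff (Ch 0%N).
have dmg z : ball 0 d z -> differentiable m (g z).
  by move=> /gV; exact: Ck_diff (Cm 0%N).
have dcomp z : ball 0 d z -> differentiable (m \o g) z.
  by move=> Bz; apply: differentiable_comp; [exact: dg|exact: dmg].
have my z : ball 0 d z -> m (g z) = m (g (vec2 (z 0 0) 0)).
  move=> Bz; apply: (const_along_y (h := m \o g) dcomp _ Bz) => y By.
  rewrite (derive_comp _ (dg _ By) (dmg _ By)) Dm; last exact: gV.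
  have [kappa _ ->] := normal_height_derive (gV _ By).
  rewrite -Dh; last exact: gV.
  rewrite -(derive_comp _ (dg _ By) (dhg _ By)).
  have -> : 'D_dy (h \o g) y = 'D_dy (fun z : 'rV[R]_2 => z 0 0) y.
    by apply: (open_eq_derive _ oB By) => z' Bz'; rewrite /= hg.
  rewrite -(derive_coord (f := id)); last exact: ex_diff.
  by rewrite derive_id vec2_0 mulr0 oppr0.
pose sig (t : R) := (sin_angle (g (vec2 t 0)))^-1.
have Bslice (t : R) : - d < t < d -> ball (0 : 'rV[R]_2) d (vec2 t 0).
  by move=> td; apply: ball2_slice => //; lra.
have oI : open (`]- d, d[%classic : set R) by exact: interval_open.
have Csig : Ck 0 (`]- d, d[%classic : set R) sig.
  apply: CkV => //.
    by move=> t /=; rewrite in_itv /= => /Bslice/gV/sin_angle_gt0/lt0r_neq0.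
  apply: (Ck_slice_x (h := sin_angle \o g) _ d0).
  by apply: (Ck_comp_scalar (E := V) oB) => //; exact: Ck_sin_angle.
have [t td|X0 dX0] := @exists_primitive R sig d d0.
  apply: differentiable_continuous; apply: (Ck_diff Csig).
  by rewrite /= in_itv.
have [W [oW WP]] : exists W, open W /\
    forall q, W q <-> [/\ U q, - (d / 2) < h q < d / 2 & - d < Y q < d].
  pose I1 : set R := `]- (d / 2), d / 2[%classic.
  pose I2 : set R := `]- d, d[%classic.
  have oh : open (V `&` h @^-1` I1).
    by apply: (open_preimage_on oV (Ch 0%N)); exact: interval_open.
  have oY : open (V `&` Y @^-1` I2).
    by apply: (open_preimage_on oV (CY 0%N)); exact: interval_open.
  exists (U `&` ((V `&` h @^-1` I1) `&` (V `&` Y @^-1` I2))).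
  split; first by do 2! apply: openI => //.
  move=> q; rewrite /I1 /I2 /= !in_itv /=; split.
    by move=> [Uq [[_ hq] [_ Yq]]].
  by move=> [Uq hq Yq]; have Vq := UV _ Uq.
have WV q : W q -> V q by move=> /WP[/UV].
have sigW q : W q -> sig (h q) = (sin_angle q)^-1.
  move=> /WP[Uq hq Yq]; rewrite /sig /sin_angle; congr (sin (acos _))^-1.
  have Bq : ball (0 : 'rV[R]_2) d (vec2 (h q) (Y q)).
    by apply: ball2_slice => //; lra.
  by have := my _ Bq; rewrite /m gK // vec2_0 => <-.
pose X q := X0 (h q) - X0 0.
have dX0h q : W q -> differentiable X0 (h q).
  by move=> /WP[_ /dX0[dX0h _] _]; exact/derivable1_diffP.
have dh q : W q -> differentiable h q := fun Wq => Ck_diff (Ch 0%N) (WV _ Wq).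
have dX q : W q -> differentiable X q.
  move=> Wq; apply: (@differentiableB _ _ _ (X0 \o h) (cst (X0 0))) => //.
  by apply: differentiable_comp; [exact: dh|exact: dX0h].
have DX q v : W q -> 'D_v X q = 'D_v f q 0 2 * (sin_angle q)^-1.
  move=> Wq; have [_ hq _] := (WP q).1 Wq.
  have -> : 'D_v X q = 'D_v (X0 \o h) q.
    have -> : X = (X0 \o h) - cst (X0 0) by [].
    rewrite deriveB ?derive_cst ?subr0 //.
    by apply: diff_derivable; apply: differentiable_comp; [exact: dh|exact: dX0h].
  rewrite (derive_comp _ (dh _ Wq) (dX0h _ Wq)) -Dh; last exact: WV.
  have := derive_linearP (1 : R) 0 ('D_v h q) (dX0h _ Wq).
  rewrite addr0 derive0 addr0 ['D_v h q *: (1 : R)]mulr1 => ->.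
  by have [_ ->] := dX0 _ hq; rewrite sigW.
exists W, X; split=> //; last split=> //.
- apply/WP; split=> //; rewrite ?Y0 /h ?f0; lra.
- by rewrite /X /h f0 subrr.
case=> [|k]; first by split.
split=> // v.
have CSW : Ck k W (fun q => (sin_angle q)^-1).
  apply: CkV => //; first by move=> q /WV/sin_angle_gt0/lt0r_neq0.
  exact: Ck_subset WV (Ck_sin_angle k).
have CfW : Ck k W (fun q => 'D_v f q 0 2).
  apply: Ck_coord => //; apply: Ck_derive; exact: Ck_subset WV (Cf k.+1).
by apply: (Ck_eq oW _ (CkM oW CfW CSW)) => q Wq; rewrite DX.
Qed.

(** Coordinates (X, Y) centred at q0 whose X-lines are the unit speed curves
    tangent to the principal direction, and along whose Y-lines neither the
    height nor the angle varies. *)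
Definition adapted_chart q0 (Y : 'rV[R]_2 -> R) (U : set 'rV[R]_2) (d : R)
    (g : 'rV[R]_2 -> 'rV[R]_2) (X : 'rV[R]_2 -> R) : Prop :=
  [/\ open U, U q0, U `<=` V, 0 < d /\ g 0 = q0 &
  [/\ forall k, Ck k U X,
      forall k, Ck k (ball 0 d) g,
      forall q, U q -> ball 0 d (vec2 (X q) (Y q)) -> g (vec2 (X q) (Y q)) = q,
      forall z, ball 0 d z -> [/\ U (g z), X (g z) = z 0 0 & Y (g z) = z 0 1] &
      forall z, ball 0 d z ->
        [/\ 'D_dx (f \o g) z = (sin_angle (g z))^-1 *: (e3 - n (g z) 0 2 *: n (g z)),
            'D_dy (f \o g) z 0 2 = 0 & 'D_dy (n \o g) z 0 2 = 0]]].

(** The coordinate field along X is u / sin theta, since both vectors have the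
    same image under the pair of differentials (dX, dY), which is injective.
    Along the field of Y the height is stationary, hence so is the angle. *)
Lemma exists_adapted_chart (Y : 'rV[R]_2 -> R) q0 :
  V q0 -> (forall k, Ck k V Y) -> Y q0 = 0 -> f q0 0 2 = 0 ->
  (forall q v, V q -> 'D_v f q 0 2 = 0 -> 'D_v Y q = 0 -> v = 0) ->
  (forall q u kappa, V q -> vertical_principal q u kappa -> 'D_u Y q = 0) ->
  exists U d g X, adapted_chart q0 Y U d g X.
Proof.
move=> Vq0 CY Y0 f0 inj YU.
have [W [X [oW Wq0 WV X0 [CX DX]]]] :=
  exists_arclength Vq0 CY Y0 f0 (fun v => inj q0 v Vq0).
have S0 q : V q -> (sin_angle q)^-1 != 0.
  by move=> /sin_angle_gt0 S0; rewrite invr_eq0 gt_eqF.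
have DX0 q v : W q -> 'D_v X q = 0 -> 'D_v f q 0 2 = 0.
  move=> Wq; rewrite DX // => /eqP; rewrite mulf_eq0 (negbTE (S0 _ (WV _ Wq))).
  by rewrite orbF => /eqP.
have injX q v : W q -> 'D_v X q = 0 -> 'D_v Y q = 0 -> v = 0.
  by move=> Wq /(DX0 _ _ Wq) h1 h2; apply: (inj q) => //; exact: WV.
have CYW k : Ck k W Y by exact: Ck_subset WV (CY k).
have [U [d [g [oU Uq0 UW d0 [gK gU Xg Yg Cg]]]]] :=
  coordinates_from_functions oW Wq0 CX CYW X0 Y0 (fun v => injX q0 v Wq0).
have oB : open (ball (0 : 'rV[R]_2) d) by exact: ball_open.
have dg z : ball 0 d z -> differentiable g z := Ck_diff (Cg 0%N).
have gW z : ball 0 d z -> W (g z) by move=> /gU/UW.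
have gV z : ball 0 d z -> V (g z) by move=> /gW/WV.
have dX z : ball 0 d z -> differentiable X (g z) :=
  fun B => Ck_diff (CX 0%N) (gW _ B).
have dY z : ball 0 d z -> differentiable Y (g z) :=
  fun B => Ck_diff (CY 0%N) (gV _ B).
have coordD (v : 'rV[R]_2) j z : 'D_v (fun z : 'rV[R]_2 => z 0 j) z = v 0 j.
  by rewrite -(derive_coord (f := id)) ?derive_id //; exact: ex_diff.
have DXg v z : ball 0 d z -> 'D_('D_v g z) X (g z) = v 0 0.
  move=> Bz; rewrite -(derive_comp _ (dg _ Bz) (dX _ Bz)) -(coordD v 0 z).
  by apply: (open_eq_derive _ oB Bz) => y By; rewrite /= Xg.
have DYg v z : ball 0 d z -> 'D_('D_v g z) Y (g z) = v 0 1.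
  move=> Bz; rewrite -(derive_comp _ (dg _ Bz) (dY _ Bz)) -(coordD v 1 z).
  by apply: (open_eq_derive _ oB Bz) => y By; rewrite /= Yg.
exists U, d, g, X; split=> //; first by move=> q /UW/WV.
  split=> //; rewrite -(gK q0) ?X0 ?Y0 //.
    by congr g; apply: rV2P; rewrite !mxE.
  by apply: ball2_slice; lra.
split=> //.
- by move=> k; exact: Ck_subset UW (CX k).
- by move=> z Bz; rewrite Xg ?Yg //; split=> //; exact: gU.
move=> z Bz; have Vz := gV _ Bz.
have dfg := dif_f Vz; have dng := dif_n Vz.
have f3y : 'D_('D_dy g z) f (g z) 0 2 = 0.
  by apply: (DX0 _ _ (gW _ Bz)); rewrite DXg // vec2_0.
rewrite !(derive_comp _ (dg _ Bz)) //; split=> //; last first.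
  by have [kappa _ ->] := normal_height_derive Vz; rewrite f3y mulr0 oppr0.
have [u [kappa Pu]] := princ Vz.
have [_ Uf _] := Pu; rewrite -Uf.
suff -> : 'D_dx g z = (sin_angle (g z))^-1 *: u.
  by have := derive_linearP u 0 (sin_angle (g z))^-1 dfg; rewrite addr0 derive0 addr0.
apply/eqP; rewrite -subr_eq0; apply/eqP; rewrite addrC -scaleNr.
apply: (injX _ _ (gW _ Bz)).
  rewrite (derive_linearP _ _ _ (dX _ Bz)) DXg // vec2_0 DX; last exact: gW.
  rewrite (vertical_derive Vz Pu) -sin_angle_sqr //.
  have := S0 _ Vz; rewrite invr_eq0 => Sz.
  by apply/eqP; rewrite addr_eq0; apply/eqP; rewrite /GRing.scale /=; field.
rewrite (derive_linearP _ _ _ (dY _ Bz)) DYg //.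
by rewrite (YU _ _ _ Vz Pu) scaler0 add0r vec2_1.
Qed.

(** Angle and height depend on X alone, and the derivative of the height is
    (1 - cos^2 theta) / sin theta. *)
Lemma adapted_chart_profile q0 Y U d g X : adapted_chart q0 Y U d g X ->
  f q0 0 2 = 0 ->
  exists theta : R -> R,
    [/\ forall k, Ck k (`]- d, d[%classic : set R) theta,
        forall z, ball 0 d z -> acos (n (g z) 0 2) = theta (z 0 0) &
        forall z, ball 0 d z -> f (g z) 0 2 = height theta (z 0 0)].
Proof.
move=> [oU Uq0 UV [d0 g0] [CX Cg gK gU Dg]] f0.
have oB : open (ball (0 : 'rV[R]_2) d) by exact: ball_open.
have dg z : ball 0 d z -> differentiable g z := Ck_diff (Cg 0%N).
have gV z : ball 0 d z -> V (g z) by move=> /gU[/UV].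
have Cfg k : Ck k (ball 0 d) (f \o g).
  exact: (Ck_comp_row oB oV gV (Cg k) (Cf k)).
have Cng k : Ck k (ball 0 d) (n \o g).
  exact: (Ck_comp_row oB oV gV (Cg k) (Cn k)).
have Ch k : Ck k (ball 0 d) (fun z => (f \o g) z 0 2) := Ck_coord 2 oB (Cfg k).
have Cm k : Ck k (ball 0 d) (fun z => (n \o g) z 0 2) := Ck_coord 2 oB (Cng k).
have hy z : ball 0 d z -> f (g z) 0 2 = f (g (vec2 (z 0 0) 0)) 0 2.
  move=> Bz; apply: (const_along_y (h := fun z => (f \o g) z 0 2) _ _ Bz) => y By.
    exact: Ck_diff (Ch 0%N) By.
  by have [_ <- _] := Dg _ By; rewrite (derive_coord _ _ (Ck_diff (Cfg 0%N) By)).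
have my z : ball 0 d z -> n (g z) 0 2 = n (g (vec2 (z 0 0) 0)) 0 2.
  move=> Bz; apply: (const_along_y (h := fun z => (n \o g) z 0 2) _ _ Bz) => y By.
    exact: Ck_diff (Cm 0%N) By.
  by have [_ _ <-] := Dg _ By; rewrite (derive_coord _ _ (Ck_diff (Cng 0%N) By)).
pose theta t : R := acos (n (g (vec2 t 0)) 0 2).
have Bslice (t : R) : - d < t < d -> ball (0 : 'rV[R]_2) d (vec2 t 0).
  by move=> td; apply: ball2_slice => //; lra.
have Ct k : Ck k (`]- d, d[%classic : set R) theta.
  apply: (Ck_slice_x (h := fun z => acos (n (g z) 0 2)) _ d0).
  exact: (Ck_comp_scalar oB gV (Cg k) (Ck_angle k)).
exists theta; split=> //; first by move=> z /my; rewrite /theta => ->.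
move=> z Bz; have [zd _] := (in_ball2 _ _).1 Bz.
rewrite hy // /height.
have g00 : vec2 0 0 = 0 :> 'rV[R]_2 by apply: rV2P; rewrite !mxE.
pose F t : R := f (g (vec2 t 0)) 0 2.
transitivity (F (z 0 0) - F 0); first by rewrite /F g00 g0 f0 subr0.
symmetry; apply: (oriented_integral_derivative (c := - d) (d := d)) => //.
- by rewrite oppr_lt0.
- move=> t td; have Bt := Bslice _ td.
  have dh y : ball 0 d y -> differentiable (fun z => (f \o g) z 0 2) y.
    exact: Ck_diff (Ch 0%N).
  apply: is_derive_eq; first exact: (derive_slice_x dh Bt).
  rewrite -derive_coord; last exact: Ck_diff (Cfg 0%N) Bt.
  have [-> _ _] := Dg _ Bt; have Vt := gV _ Bt.
  have S0 := sin_angle_gt0 Vt; have SS := sin_angle_sqr Vt.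
  transitivity ((sin_angle (g (vec2 t 0)))^-1 * sin_angle (g (vec2 t 0)) ^+ 2).
    by rewrite SS !mxE /= expr2.
  by rewrite expr2 mulKf // gt_eqF.
- move=> t td; apply: (continuous_comp (f := theta) (g := sin)).
    apply: differentiable_continuous; apply: (Ck_diff (Ct 0%N)).
    by rewrite /= in_itv.
  exact: continuous_sin.
Qed.

(** The polar angle of the horizontal part of - n, in the half plane where that
    vector has a positive first entry. *)
Definition polar_angle q : R := atan (n q 0 1 / n q 0 0).

Hypothesis facing : forall q, V q -> n q 0 0 < 0.

Let horizontal_sqr q : V q -> n q 0 0 ^+ 2 + n q 0 1 ^+ 2 = sin_angle q ^+ 2.
Proof. by move=> Vq; rewrite sin_angle_sqr // -(n_unit Vq) dotE; ring. Qed.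

Lemma polar_angleP q : V q ->
  sin_angle q * cos (polar_angle q) = - n q 0 0 /\
  sin_angle q * sin (polar_angle q) = - n q 0 1.
Proof.
move=> Vq; have N1 := facing Vq; have hs := horizontal_sqr Vq.
have S0 := sin_angle_gt0 Vq.
rewrite /polar_angle; set t := n q 0 1 / n q 0 0.
have tE : n q 0 1 = t * n q 0 0 by rewrite /t divfK // lt_eqF.
have c0 : 0 < cos (atan t).
  by rewrite cos_atan invr_gt0 sqrtr_gt0 ltr_pwDl ?sqr_ge0.
have sE : sin (atan t) = t * cos (atan t).
  by rewrite -[X in X * _]atanK /tan divfK // gt_eqF.
have cE := cos2Dsin2 (atan t).
have Sc : sin_angle q * cos (atan t) = - n q 0 0.
  apply/eqP; rewrite -(@eqrXn2 _ 2) // ?oppr_ge0 ?mulr_ge0 1?ltW //.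
  by apply/eqP; rewrite exprMn sqrrN -hs tE -[RHS]mulr1 -cE sE; ring.
by split=> //; rewrite sE mulrCA Sc tE; ring.
Qed.

Lemma Ck_polar_angle k : Ck k V polar_angle.
Proof.
apply: (Ck_comp_real (I := setT) (g := fun q => n q 0 1 / n q 0 0) oV) => //.
  apply: CkM => //; first exact: Ck_coord.
  by apply: CkV => //; [move=> q /facing/lt_eqF/negbT|exact: Ck_coord].
exact: Ck_atan.
Qed.

Lemma polar_angle_derive q v : V q ->
  sin_angle q ^+ 2 * 'D_v polar_angle q =
  n q 0 0 * 'D_v n q 0 1 - n q 0 1 * 'D_v n q 0 0.
Proof.
move=> Vq; have N1 := lt_eqF (facing Vq); have dn := dif_n Vq.
have d1 : differentiable (fun y => n y 0 0) q by exact: differentiable_entry.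
have d2 : differentiable (fun y => n y 0 1) q by exact: differentiable_entry.
pose t y : R := n y 0 1 * (n y 0 0)^-1.
have dV : differentiable (fun y => (n y 0 0)^-1) q.
  by apply: differentiableV => //; rewrite N1.
have dt : differentiable t q by exact: differentiableM.
have Dt : 'D_v t q * n q 0 0 ^+ 2 =
    n q 0 0 * 'D_v n q 0 1 - n q 0 1 * 'D_v n q 0 0.
  rewrite (deriveM (f := fun y => n y 0 1) (g := fun y => (n y 0 0)^-1));
    try exact: diff_derivable.
  rewrite deriveV ?N1 //; last exact: diff_derivable.
  rewrite !(derive_coord v _ dn) /GRing.scale /=; field; by rewrite N1.
have da : differentiable (@atan R) (t q).
  by have [+ _] := is_derive1_atan (t q) => ?; exact/derivable1_diffP.
have -> : 'D_v polar_angle q = 'D_v t q * (1 + t q ^+ 2)^-1.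
  rewrite (derive_comp (f := @atan R) _ dt da).
  have := derive_linearP (1 : R) 0 ('D_v t q) da.
  rewrite addr0 derive0 addr0 ['D_v t q *: (1 : R)]mulr1 => ->.
  by have [_ ->] := is_derive1_atan (t q).
rewrite -Dt -horizontal_sqr //.
have t1 : 1 + t q ^+ 2 != 0 by rewrite gt_eqF // ltr_pwDl ?sqr_ge0.
have -> : n q 0 1 = t q * n q 0 0 by rewrite /t divfK // N1.
by field.
Qed.

Lemma polar_angle_principal q u kappa : V q -> vertical_principal q u kappa ->
  'D_u polar_angle q = 0.
Proof.
move=> Vq [_ Uf Un].
have : sin_angle q ^+ 2 * 'D_u polar_angle q = 0.
  by rewrite polar_angle_derive // Un Uf !mxE /=; ring.
by move=> /eqP; rewrite mulf_eq0 sqrf_eq0 gt_eqF ?sin_angle_gt0 //= => /eqP.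
Qed.

(** When the height does not vary, the vertical entry of the normal does not;
    when the polar angle does not vary, the direction of its horizontal part
    does not; and its length is fixed. *)
Lemma gauss_map_kernel q v : V q -> 'D_v f q 0 2 = 0 ->
  'D_v polar_angle q = 0 -> 'D_v n q = 0.
Proof.
move=> Vq f3 pa; have N1 := facing Vq.
have [kappa _ n3] := normal_height_derive Vq.
have {n3}n3 : 'D_v n q 0 2 = 0 by rewrite n3 f3 mulr0 oppr0.
have := polar_angle_derive v Vq; rewrite pa mulr0 => /esym h1.
have := normal_derive_normal v Vq; rewrite dotE n3 mulr0 addr0 => h2.
have hs : n q 0 0 ^+ 2 + n q 0 1 ^+ 2 != 0.
  by rewrite gt_eqF // ltr_pwDl ?sqr_ge0 // exprn_even_gt0 //= lt_eqF.
apply: rV3P; rewrite mxE //; apply: (mulfI hs); rewrite mulr0.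
  transitivity (n q 0 0 * (n q 0 0 * 'D_v n q 0 0 + n q 0 1 * 'D_v n q 0 1) -
    n q 0 1 * (n q 0 0 * 'D_v n q 0 1 - n q 0 1 * 'D_v n q 0 0)); first by ring.
  by rewrite h1 h2; ring.
transitivity (n q 0 1 * (n q 0 0 * 'D_v n q 0 0 + n q 0 1 * 'D_v n q 0 1) +
    n q 0 0 * (n q 0 0 * 'D_v n q 0 1 - n q 0 1 * 'D_v n q 0 0)); first by ring.
by rewrite h1 h2; ring.
Qed.

Hypothesis imm : forall q v, V q -> 'D_v f q = 0 -> v = 0.

(** Where the Gauss map is degenerate its kernel is a horizontal tangent
    vector a.  By symmetry of the shape operator every derivative of the normal
    is orthogonal to a, so the horizontal part of that derivative is parallel to
    the horizontal part of the normal: the polar angle is stationary. *)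
Lemma polar_angle_stationary q w v : V q -> w != 0 -> 'D_w n q = 0 ->
  'D_v polar_angle q = 0.
Proof.
move=> Vq w0 Dw; have [kappa k0 n3] := normal_height_derive Vq.
have a3 : 'D_w f q 0 2 = 0.
  have /esym/eqP := n3 w; rewrite Dw mxE oppr_eq0 mulf_eq0 (negbTE k0) /=.
  by move=> /eqP.
have := n_normal w Vq; rewrite dotE a3 mulr0 addr0 => aN.
have := shape_symmetric v w Vq; rewrite Dw dot0l dotE a3 mulr0 addr0 => aD.
have a0 : 'D_w f q 0 0 ^+ 2 + 'D_w f q 0 1 ^+ 2 != 0.
  apply: contra_neq w0 => a0; apply: (imm Vq).
  by apply: dot_eq0; rewrite dotE a3 -!expr2 a0 expr0n addr0.
have : sin_angle q ^+ 2 * ('D_w f q 0 0 ^+ 2 + 'D_w f q 0 1 ^+ 2) *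
    'D_v polar_angle q = 0.
  rewrite mulrAC polar_angle_derive //.
  (* Lagrange's identity in the horizontal plane *)
  transitivity ((n q 0 0 * 'D_w f q 0 0 + n q 0 1 * 'D_w f q 0 1) *
      ('D_w f q 0 0 * 'D_v n q 0 1 - 'D_w f q 0 1 * 'D_v n q 0 0) -
    ('D_v n q 0 0 * 'D_w f q 0 0 + 'D_v n q 0 1 * 'D_w f q 0 1) *
      ('D_w f q 0 0 * n q 0 1 - 'D_w f q 0 1 * n q 0 0)); first by ring.
  by rewrite aN aD; ring.
move=> /eqP; rewrite mulf_eq0 mulf_eq0 (negbTE a0) orbF sqrf_eq0.
by rewrite gt_eqF ?sin_angle_gt0 //= => /eqP.
Qed.

(** The normal forms read in the parameter plane, Phi and g being the change of
    coordinates and its inverse.  The frame of space is adapted to q0, so that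
    the direction y0 of a cylinder is 0. *)
Definition patch_normal_form q0 : Prop :=
  exists (U : set 'rV[R]_2) (d : R) (g Phi : 'rV[R]_2 -> 'rV[R]_2)
      (theta phi : R -> R),
    [/\ [/\ open U, U q0, U `<=` V & 0 < d /\ ball 0 d (Phi q0)],
        [/\ forall k, Ck k U Phi, forall k, Ck k (ball 0 d) g,
          forall q, U q -> ball 0 d (Phi q) -> g (Phi q) = q &
          forall z, ball 0 d z -> U (g z) /\ Phi (g z) = z],
        [/\ forall k, Ck k (`]- d, d[%classic : set R) theta,
          forall z, ball 0 d z -> acos (n (g z) 0 2) = theta (z 0 0) &
          forall t : R, - d < t < d -> is_derive t (1 : R) phi (cos (theta t))] &
        (exists2 psi : R -> R, forall k, Ck k (`]- d, d[%classic : set R) psi &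
           forall z, ball 0 d z ->
             f (g z) = case1_param theta phi psi (z 0 0) (z 0 1))
        \/
        (forall z, ball 0 d z ->
           f (g z) = case2_param theta phi 0 (z 0 0) (z 0 1))].

Lemma adapted_chart_normal_form q0 Y U d g X (theta phi : R -> R) :
  adapted_chart q0 Y U d g X -> (forall k, Ck k V Y) ->
  (forall k, Ck k (`]- d, d[%classic : set R) theta) ->
  (forall z, ball 0 d z -> acos (n (g z) 0 2) = theta (z 0 0)) ->
  (forall t : R, - d < t < d -> is_derive t (1 : R) phi (cos (theta t))) ->
  (exists2 psi : R -> R, forall k, Ck k (`]- d, d[%classic : set R) psi &
     forall z, ball 0 d z -> f (g z) = case1_param theta phi psi (z 0 0) (z 0 1))
  \/
  (forall z, ball 0 d z -> f (g z) = case2_param theta phi 0 (z 0 0) (z 0 1)) ->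
  patch_normal_form q0.
Proof.
move=> [oU Uq0 UV [d0 g0] [CX Cg gK gU _]] CY Ct tE Dphi form.
have B0 : ball (0 : 'rV[R]_2) d 0 by exact: ballxx.
exists U, d, g, (fun q => vec2 (X q) (Y q)), theta, phi; split=> //.
- split=> //; split=> //; have [_] := gU _ B0; rewrite g0 => -> ->.
  by rewrite -vec2E.
- split=> //.
    move=> k; apply: Ck_row => // j; have [->|->] := ord2P j.
      by apply: (Ck_eq oU _ (CX k)) => q _; rewrite vec2_0.
    apply: (Ck_eq oU _ (Ck_subset UV (CY k))) => q _; by rewrite vec2_1.
  by move=> z /gU[Uz -> ->]; rewrite -vec2E.
Qed.

(** The X-lines have velocity U / sin theta = cos theta e + sin theta e3, where
    e is the unit horizontal vector of angle eta. *)
Lemma adapted_chart_dx q0 Y U d g X z eta :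
  adapted_chart q0 Y U d g X -> ball 0 d z ->
  sin_angle (g z) * cos eta = - n (g z) 0 0 ->
  sin_angle (g z) * sin eta = - n (g z) 0 1 ->
  'D_dx (f \o g) z 0 0 = n (g z) 0 2 * cos eta /\
  'D_dx (f \o g) z 0 1 = n (g z) 0 2 * sin eta.
Proof.
move=> [_ _ UV _ [_ _ _ gU Dg]] Bz h1 h2.
have [Uz _ _] := gU _ Bz; have S0 := sin_angle_gt0 (UV _ Uz).
have [-> _ _] := Dg _ Bz.
split; rewrite !mxE /= sub0r -mulrN.
  by rewrite -h1 mulrCA mulKf // gt_eqF.
by rewrite -h2 mulrCA mulKf // gt_eqF.
Qed.

(** The Y-lines are horizontal and orthogonal to the normal, hence orthogonal to
    its horizontal part. *)
Lemma adapted_chart_dy q0 Y U d g X z eta :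
  adapted_chart q0 Y U d g X -> ball 0 d z ->
  sin_angle (g z) * cos eta = - n (g z) 0 0 ->
  sin_angle (g z) * sin eta = - n (g z) 0 1 ->
  cos eta * 'D_dy (f \o g) z 0 0 + sin eta * 'D_dy (f \o g) z 0 1 = 0.
Proof.
move=> [_ _ UV _ [_ Cg _ gU Dg]] Bz h1 h2.
have [Uz _ _] := gU _ Bz; have Vz := UV _ Uz; have S0 := sin_angle_gt0 Vz.
have [_ f3 _] := Dg _ Bz.
have := n_normal ('D_dy g z) Vz.
rewrite -(derive_comp _ (Ck_diff (Cg 0%N) Bz) (dif_f Vz)) dotE f3 mulr0 addr0.
move=> h; apply: (mulfI (lt0r_neq0 S0)); rewrite mulr0 mulrDr !mulrA h1 h2.
by rewrite !mulNr -opprD h oppr0.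
Qed.

Lemma derive0_const_real (h : R -> R) (d x : R) : 0 < d ->
  (forall t : R, - d < t < d -> is_derive t (1 : R) h 0) -> - d < x < d ->
  h x = h 0.
Proof.
move=> d0 dh xd; rewrite -[in LHS](add0r x).
have inb (t : R) : ball (0 : R) d t -> - d < t < d.
  by rewrite -ball_normE /ball_ /= sub0r normrN ltr_norml.
apply: (@derive0_ball_const _ R h 0 _ _ d).
- by move=> t /inb/dh[dt _]; exact/derivable1_diffP.
- move=> t /inb/dh[/derivable1_diffP dt Dt].
  have := derive_linearP (1 : R) 0 x dt.
  by rewrite addr0 derive0 addr0 [x *: (1 : R)]mulr1 Dt scaler0.
- exact: ballxx.
- by rewrite add0r -ball_normE /ball_ /= sub0r normrN ltr_norml.
Qed.

(** Where the Gauss map is a local diffeomorphism the polar angle of the normal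
    serves as the coordinate y.  With e(y) the unit vector of angle y, the
    x-derivative of the horizontal part of f is cos theta(x) e(y), so f minus
    phi(x) e(y) is a plane curve in y.  Its velocity is orthogonal to e(y), that
    is, of the form psi(y) e'(y). *)
Lemma patch_case1 q0 : V q0 -> f q0 = 0 -> n q0 0 1 = 0 ->
  (forall q v, V q -> 'D_v n q = 0 -> v = 0) -> patch_normal_form q0.
Proof.
move=> Vq0 f0 n0 nondeg.
have Y0 : polar_angle q0 = 0 by rewrite /polar_angle n0 mul0r atan0.
have f3 : f q0 0 2 = 0 by rewrite f0 mxE.
have [U [d [g [X ad]]]] := exists_adapted_chart Vq0 Ck_polar_angle Y0 f3
  (fun q v Vq h1 h2 => nondeg q v Vq (gauss_map_kernel Vq h1 h2))
  polar_angle_principal.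
have [theta [Ct tE hE]] := adapted_chart_profile ad f3.
have [oU Uq0 UV [d0 g0] [CX Cg gK gU Dg]] := ad.
have oB : open (ball (0 : 'rV[R]_2) d) by exact: ball_open.
have gV z : ball 0 d z -> V (g z) by move=> /gU[/UV].
have Cfg k : Ck k (ball 0 d) (f \o g).
  exact: (Ck_comp_row oB oV gV (Cg k) (Cf k)).
have dfg z : ball 0 d z -> differentiable (f \o g) z := Ck_diff (Cfg 0%N).
pose a z : R := (f \o g) z 0 0; pose b z : R := (f \o g) z 0 1.
have Ca k : Ck k (ball 0 d) a := Ck_coord 0 oB (Cfg k).
have Cb k : Ck k (ball 0 d) b := Ck_coord 1 oB (Cfg k).
have da z : ball 0 d z -> differentiable a z := Ck_diff (Ca 0%N).
have db z : ball 0 d z -> differentiable b z := Ck_diff (Cb 0%N).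
have polar (z : 'rV[R]_2) : ball 0 d z ->
    sin_angle (g z) * cos (z 0 1) = - n (g z) 0 0 /\
    sin_angle (g z) * sin (z 0 1) = - n (g z) 0 1.
  by move=> Bz; have [_ _ <-] := gU _ Bz; exact/polar_angleP/gV.
have n3 (z : 'rV[R]_2) : ball 0 d z -> n (g z) 0 2 = cos (theta (z 0 0)).
  move=> Bz; rewrite -tE // acosK //.
  by have /slope/andP[h1 h2] := gV _ Bz; rewrite in_itv /= !ltW.
have Dx (z : 'rV[R]_2) : ball 0 d z ->
    'D_dx a z = cos (theta (z 0 0)) * cos (z 0 1) /\
    'D_dx b z = cos (theta (z 0 0)) * sin (z 0 1).
  move=> Bz; have [h1 h2] := polar _ Bz.
  have [] := adapted_chart_dx ad Bz h1 h2.
  by rewrite n3 // !(derive_coord dx _ (dfg _ Bz)).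
have Dy (z : 'rV[R]_2) : ball 0 d z ->
    cos (z 0 1) * 'D_dy a z + sin (z 0 1) * 'D_dy b z = 0.
  move=> Bz; have [h1 h2] := polar _ Bz.
  have := adapted_chart_dy ad Bz h1 h2.
  by rewrite !(derive_coord dy _ (dfg _ Bz)).
have z00 : vec2 0 0 = 0 :> 'rV[R]_2 by apply: rV2P; rewrite !mxE.
have a0 : a (vec2 0 0) = 0 by rewrite z00 /a /= g0 f0 mxE.
have b0 : b (vec2 0 0) = 0 by rewrite z00 /b /= g0 f0 mxE.
pose phi t := a (vec2 t 0).
have d00 : - d < 0 < d by lra.
have Dphi (t : R) : - d < t < d -> is_derive t (1 : R) phi (cos (theta t)).
  move=> td; have Bt := ball2_slice td d00.
  have := derive_slice_x da Bt; have [-> _] := Dx _ Bt.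
  by rewrite vec2_0 vec2_1 cos0 mulr1.
(* subtracting phi times the unit vector of angle y leaves a function of y *)
have aE (z : 'rV[R]_2) : ball 0 d z ->
    a z = phi (z 0 0) * cos (z 0 1) + a (vec2 0 (z 0 1)).
  move=> Bz; have [xd yd] := (in_ball2 _ _).1 Bz.
  pose h (t : R) := a (vec2 t (z 0 1)) - phi t * cos (z 0 1).
  have hc : h (z 0 0) = h 0.
    apply: (derive0_const_real d0 _ xd) => t td; have Bt := ball2_slice td yd.
    have D1 := derive_slice_x da Bt; have D2 := Dphi _ td.
    have D3 := is_deriveM D2 (is_derive_cst (cos (z 0 1)) t (1 : R)).
    apply: (is_derive_eq (is_deriveB D1 D3)).
    have [-> _] := Dx _ Bt; rewrite vec2_0 vec2_1 /GRing.scale /=; ring.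
  have phi0 : phi 0 = 0 by exact: a0.
  move: hc; rewrite /h -vec2E phi0 mul0r subr0 => <-.
  by rewrite addrC subrK.
have bE (z : 'rV[R]_2) : ball 0 d z ->
    b z = phi (z 0 0) * sin (z 0 1) + b (vec2 0 (z 0 1)).
  move=> Bz; have [xd yd] := (in_ball2 _ _).1 Bz.
  pose h (t : R) := b (vec2 t (z 0 1)) - phi t * sin (z 0 1).
  have hc : h (z 0 0) = h 0.
    apply: (derive0_const_real d0 _ xd) => t td; have Bt := ball2_slice td yd.
    have D1 := derive_slice_x db Bt; have D2 := Dphi _ td.
    have D3 := is_deriveM D2 (is_derive_cst (sin (z 0 1)) t (1 : R)).
    apply: (is_derive_eq (is_deriveB D1 D3)).
    have [_ ->] := Dx _ Bt; rewrite vec2_0 vec2_1 /GRing.scale /=; ring.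
  have phi0 : phi 0 = 0 by exact: a0.
  move: hc; rewrite /h -vec2E phi0 mul0r subr0 => <-.
  by rewrite addrC subrK.
pose psi (t : R) := - sin t * 'D_dy a (vec2 0 t) + cos t * 'D_dy b (vec2 0 t).
have oI : open (`]- d, d[%classic : set R) by exact: interval_open.
have Cpsi k : Ck k (`]- d, d[%classic : set R) psi.
  apply: (CkD oI); apply: (CkM oI).
  - by apply: (CkN oI); exact: Ck_sin.
  - exact: (Ck_slice_y (Ck_derive dy (Ca k.+1)) d0).
  - exact: Ck_cos.
  - exact: (Ck_slice_y (Ck_derive dy (Cb k.+1)) d0).
have psi_ab (t : R) : - d < t < d ->
    - (psi t * sin t) = 'D_dy a (vec2 0 t) /\ psi t * cos t = 'D_dy b (vec2 0 t).
  move=> td; have Bt := ball2_slice d00 td.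
  have := Dy _ Bt; rewrite vec2_1 => h; have cs := cos2Dsin2 t.
  rewrite /psi; split.
    transitivity ((cos t ^+ 2 + sin t ^+ 2) * 'D_dy a (vec2 0 t) - cos t *
      (cos t * 'D_dy a (vec2 0 t) + sin t * 'D_dy b (vec2 0 t))); first by ring.
    by rewrite h cs; ring.
  transitivity ((cos t ^+ 2 + sin t ^+ 2) * 'D_dy b (vec2 0 t) - sin t *
    (cos t * 'D_dy a (vec2 0 t) + sin t * 'D_dy b (vec2 0 t))); first by ring.
  by rewrite h cs; ring.
have cpsi (w : R -> R) t : (forall k, Ck k (`]- d, d[%classic : set R) w) ->
    - d < t < d -> {for t, continuous (fun t => psi t * w t)}.
  move=> Cw td; apply: differentiable_continuous.
  apply: (Ck_diff (CkM oI (Cpsi 0%N) (Cw 0%N))).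
  by rewrite /= in_itv.
apply: (adapted_chart_normal_form ad Ck_polar_angle Ct tE Dphi); left.
exists psi => // z Bz; have [xd yd] := (in_ball2 _ _).1 Bz.
have dN : - d < 0 by lra.
have int_a : oriented_integral 0 (z 0 1) (fun t => psi t * sin t) =
    - a (vec2 0 (z 0 1)) - - a (vec2 0 0).
  apply: (oriented_integral_derivative (F := fun t => - a (vec2 0 t)) dN d0) => //.
  - move=> t td; have Bt := ball2_slice d00 td.
    apply: (is_derive_eq (is_deriveN (derive_slice_y da Bt))).
    by have [<- _] := psi_ab _ td; rewrite opprK.
  - by move=> t td; apply: cpsi => // k; exact: Ck_sin.
have int_b : oriented_integral 0 (z 0 1) (fun t => psi t * cos t) =
    b (vec2 0 (z 0 1)) - b (vec2 0 0).
  apply: (oriented_integral_derivative (F := fun t => b (vec2 0 t)) dN d0) => //.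
  - move=> t td; have Bt := ball2_slice d00 td.
    apply: (is_derive_eq (derive_slice_y db Bt)).
    by have [_ <-] := psi_ab _ td.
  - by move=> t td; apply: cpsi => // k; exact: Ck_cos.
apply: rV3P.
- by rewrite /case1_param vec3_0 -/(a z) aE // int_a a0; ring.
- by rewrite /case1_param vec3_1 -/(b z) bE // int_b b0; ring.
- by rewrite /case1_param vec3_2 hE.
Qed.

(** Where the Gauss map is degenerate throughout, the horizontal part of the
    normal keeps the fixed direction of the first axis, and the second entry of
    f serves as the coordinate y.  That the polar angle is constant uses the
    connectedness of the ball. *)
Lemma patch_case2 q0 (r : R) : V q0 -> V `<=` ball q0 r -> ball q0 r `<=` V ->
  f q0 = 0 -> n q0 0 1 = 0 ->
  (forall q, V q -> exists2 w, w != 0 & 'D_w n q = 0) -> patch_normal_form q0.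
Proof.
move=> Vq0 VB BV f0 n0 deg.
have dpa q : V q -> differentiable polar_angle q := Ck_diff (Ck_polar_angle 0).
have pa0 q : V q -> polar_angle q = 0.
  move=> Vq; transitivity (polar_angle q0); last first.
    by rewrite /polar_angle n0 mul0r atan0.
  rewrite -(subrKC q0 q); apply: (@derive0_ball_const _ _ polar_angle q0 _ _ r).
  - by move=> y /BV; exact: dpa.
  - move=> y /BV Vy; have [w w0 Dw] := deg _ Vy.
    exact: (polar_angle_stationary _ Vy w0 Dw).
  - exact: VB.
  - by rewrite subrKC; exact: VB.
have n2 q : V q -> n q 0 1 = 0.
  move=> Vq; have [_] := polar_angleP Vq; rewrite pa0 // sin0 mulr0.
  by move=> /esym/eqP; rewrite oppr_eq0 => /eqP.
pose Y q : R := f q 0 1.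
have CY k : Ck k V Y := Ck_coord 1 oV (Cf k).
have Y0 : Y q0 = 0 by rewrite /Y f0 mxE.
have f3 : f q0 0 2 = 0 by rewrite f0 mxE.
have DY q v : V q -> 'D_v Y q = 'D_v f q 0 1.
  by move=> Vq; rewrite (derive_coord v 1 (dif_f Vq)).
have [q v Vq h3|q u kappa Vq [_ Uf _]|U [d [g [X ad]]]] :=
  exists_adapted_chart Vq0 CY Y0 f3.
- rewrite DY // => h2; apply: (imm Vq); apply: rV3P; rewrite mxE //.
  have := n_normal v Vq; rewrite dotE h2 h3 !mulr0 !addr0 => /eqP.
  by rewrite mulf_eq0 lt_eqF ?facing //= => /eqP.
- by rewrite DY // Uf !mxE /= n2 //; ring.
have [theta [Ct tE hE]] := adapted_chart_profile ad f3.
have [oU Uq0 UV [d0 g0] [CX Cg gK gU Dg]] := ad.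
have oB : open (ball (0 : 'rV[R]_2) d) by exact: ball_open.
have gV z : ball 0 d z -> V (g z) by move=> /gU[/UV].
have Cfg k : Ck k (ball 0 d) (f \o g).
  exact: (Ck_comp_row oB oV gV (Cg k) (Cf k)).
have dfg z : ball 0 d z -> differentiable (f \o g) z := Ck_diff (Cfg 0%N).
pose a z : R := (f \o g) z 0 0.
have Ca k : Ck k (ball 0 d) a := Ck_coord 0 oB (Cfg k).
have da z : ball 0 d z -> differentiable a z := Ck_diff (Ca 0%N).
have polar z : ball 0 d z ->
    sin_angle (g z) * cos 0 = - n (g z) 0 0 /\
    sin_angle (g z) * sin 0 = - n (g z) 0 1.
  by move=> Bz; have := polar_angleP (gV _ Bz); rewrite pa0 //; exact: gV.
pose phi t := a (vec2 t 0).
have d00 : - d < 0 < d by lra.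
have Dphi (t : R) : - d < t < d -> is_derive t (1 : R) phi (cos (theta t)).
  move=> td; have Bt := ball2_slice td d00.
  apply: (is_derive_eq (derive_slice_x da Bt)).
  have [h1 h2] := polar _ Bt; have [] := adapted_chart_dx ad Bt h1 h2.
  rewrite (derive_coord dx _ (dfg _ Bt)) cos0 mulr1 => -> _.
  have := tE _ Bt; rewrite vec2_0 => <-; rewrite acosK //.
  by have /slope/andP[h3 h4] := gV _ Bt; rewrite in_itv /= !ltW.
apply: (adapted_chart_normal_form ad CY Ct tE Dphi); right=> z Bz.
have aE : a z = phi (z 0 0).
  apply: (const_along_y da _ Bz) => y By.
  have [h1 h2] := polar _ By; have := adapted_chart_dy ad By h1 h2.
  by rewrite cos0 sin0 mul1r mul0r addr0 (derive_coord dy _ (dfg _ By)).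
have [_ _ Yz] := gU _ Bz.
apply: rV3P; rewrite /case2_param !mxE /= ?cos0 ?sin0.
- by rewrite -[f (g z) 0 0]/(a z) aE; ring.
- by rewrite -[f (g z) 0 1]/(Y (g z)) Yz; ring.
- by rewrite hE //; ring.
Qed.

End surface_patch.

(** It suffices to work on a ball around q0 where the first entry of the normal
    stays negative. *)
Theorem patch_normal_form_exists (R : realType) (V : set 'rV[R]_2)
    (f n : 'rV[R]_2 -> 'rV[R]_3) (q0 : 'rV[R]_2) :
  open V -> V q0 -> (forall k, Ck k V f) -> (forall k, Ck k V n) ->
  (forall q, V q -> dot (n q) (n q) = 1) ->
  (forall q v, V q -> dot (n q) ('D_v f q) = 0) ->
  (forall q, V q -> exists u kappa, vertical_principal f n q u kappa) ->
  (forall q, V q -> -1 < n q 0 2 < 1) ->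
  (forall q v, V q -> 'D_v f q = 0 -> v = 0) ->
  f q0 = 0 -> n q0 0 1 = 0 -> n q0 0 0 < 0 ->
  (forall q v, V q -> 'D_v n q = 0 -> v = 0) \/
  (forall q, V q -> exists2 w, w != 0 & 'D_w n q = 0) ->
  patch_normal_form V f n q0.
Proof.
move=> oV Vq0 Cf Cn n_unit n_normal princ slope imm f0 n2 n1 gauss.
have [r r0 Br] : exists2 r : R, 0 < r &
    ball q0 r `<=` V `&` [set q | n q 0 0 < 0].
  have oW : open (V `&` (fun q => n q 0 0) @^-1` [set x : R | x < 0]).
    by apply: (open_preimage_on oV (Ck_coord 0 oV (Cn 0%N))); exact: open_lt.
  have /(@nbhs_ballP R 'rV[R]_2)[r /= r0 Br] := open_nbhs_nbhs (conj oW (conj Vq0 n1)).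
  by exists r.
have BV q : ball q0 r q -> V q by move=> /Br[].
have facing q : ball q0 r q -> n q 0 0 < 0 by move=> /Br[].
have Bq0 : ball q0 r q0 by exact: ballxx.
have oB : open (ball q0 r) by exact: ball_open.
have CfB k : Ck k (ball q0 r) f := Ck_subset BV (Cf k).
have CnB k : Ck k (ball q0 r) n := Ck_subset BV (Cn k).
suff [U [d [g [Phi [theta [phi [[oU Uq0 UB d0] H1 H2 H3]]]]]]] :
    patch_normal_form (ball q0 r) f n q0.
  exists U, d, g, Phi, theta, phi; split=> //; split=> //.
  by move=> q /UB/BV.
have unitB q (Bq : ball q0 r q) := n_unit q (BV q Bq).
have normalB q v (Bq : ball q0 r q) := n_normal q v (BV q Bq).
have princB q (Bq : ball q0 r q) := princ q (BV q Bq).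
have slopeB q (Bq : ball q0 r q) := slope q (BV q Bq).
have immB q v (Bq : ball q0 r q) := imm q v (BV q Bq).
case: gauss => [nondeg|deg].
  by apply: (patch_case1 oB CfB CnB) => // q v /BV; exact: nondeg.
apply: (patch_case2 oB CfB CnB unitB normalB princB slopeB facing immB Bq0
  (@subset_refl _ _) (@subset_refl _ _)) => // q /BV; exact: deg.
Qed.

(** * Orthonormal frames *)
Section frames.
Variable R : realType.
Implicit Types (a b k m u v w : 'rV[R]_3).

Definition rows3 a b m : 'M[R]_3 := \matrix_(i < 3) [:: a; b; m]`_i.

Lemma mulmx_rows3 (x : 'rV[R]_3) a b m :
  x *m rows3 a b m = x 0 0 *: a + x 0 1 *: b + x 0 2 *: m.
Proof.
have s3 (F : 'I_3 -> 'rV[R]_3) : \sum_i F i = F 0 + F 1 + F 2.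
  rewrite !big_ord_recl big_ord0 addr0 addrA.
  by congr (F _ + F _ + F _); exact: val_inj.
by rewrite mulmx_sum_row s3 !rowK.
Qed.

(** For vectors orthogonal to the unit vector m, independence becomes the
    invertibility of a matrix, an open condition. *)
Lemma rows3_unitmxP a b m : dot m m = 1 -> dot m a = 0 -> dot m b = 0 ->
  reflect (forall x y, x *: a + y *: b = 0 -> x = 0 /\ y = 0)
          (rows3 a b m \in unitmx).
Proof.
move=> mm ma mb; apply: (iffP idP) => [um x y xy|inj].
  have : vec3 x y 0 = 0 :> 'rV[R]_3.
    apply: (can_inj (mulmxK um)); rewrite mul0mx mulmx_rows3.
    by rewrite vec3_0 vec3_1 vec3_2 scale0r addr0.
  by move=> /rowP h; have := h 0; have := h 1; rewrite vec3_0 vec3_1 !mxE.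
rewrite -row_free_unit; apply: inj_row_free => x; rewrite mulmx_rows3 => h.
have x2 : x 0 2 = 0.
  have := congr1 (dot m) h; rewrite !dotDr !dotZr ma mb mm.
  by rewrite (dotC m 0) dot0l !mulr0 mulr1 !add0r.
move: h; rewrite x2 scale0r addr0 => /inj[x0 x1].
by apply: rV3P; rewrite mxE.
Qed.

Lemma tangent_plane_span a b m w : dot m m = 1 -> dot m a = 0 -> dot m b = 0 ->
  (forall x y, x *: a + y *: b = 0 -> x = 0 /\ y = 0) -> dot m w = 0 ->
  exists x y, w = x *: a + y *: b.
Proof.
move=> mm ma mb /(rows3_unitmxP mm ma mb) um mw.
have := mulmxKV um w; set x := w *m _; rewrite mulmx_rows3 => wE.
have x2 : x 0 2 = 0.
  have := congr1 (dot m) wE; rewrite !dotDr !dotZr ma mb mm mw.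
  by rewrite !mulr0 mulr1 !add0r.
by exists (x 0 0), (x 0 1); rewrite -wE x2 scale0r addr0.
Qed.

Lemma dot_mulmx u v : dot u v = (u *m v^T) 0 0.
Proof. by rewrite mxE; apply: eq_bigr => i _; rewrite mxE. Qed.

Lemma dot_orthogonal (K : 'M[R]_3) u v : K *m K^T = 1%:M ->
  dot (u *m K) (v *m K) = dot u v.
Proof.
by move=> KK; rewrite !dot_mulmx trmx_mul mulmxA -(mulmxA u) KK mulmx1.
Qed.

Definition cross k m : 'rV[R]_3 :=
  vec3 (k 0 1 * m 0 2 - k 0 2 * m 0 1) (k 0 2 * m 0 0 - k 0 0 * m 0 2)
       (k 0 0 * m 0 1 - k 0 1 * m 0 0).

Lemma exists_orthogonal_frame k m : dot k k = 1 -> dot m m = 1 -> dot m k = 0 ->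
  exists K : 'M[R]_3,
    [/\ K *m K^T = 1%:M, m *m K = vec3 1 0 0 & k *m K = vec3 0 0 1].
Proof.
move=> kk mm mk; pose b := cross k m; pose P := rows3 m b k.
have bb : dot b b = 1.
  transitivity (dot k k * dot m m - dot m k ^+ 2).
    by rewrite !dotE /b vec3_0 vec3_1 vec3_2; ring.
  by rewrite kk mm mk; ring.
have bk : dot b k = 0 by rewrite !dotE /b vec3_0 vec3_1 vec3_2; ring.
have bm : dot b m = 0 by rewrite !dotE /b vec3_0 vec3_1 vec3_2; ring.
have mPE w : w *m P^T = vec3 (dot w m) (dot w b) (dot w k).
  by apply: rV3P; rewrite ?vec3_0 ?vec3_1 ?vec3_2 dot_mulmx !mxE;
     apply: eq_bigr => i _; rewrite !mxE.
have PP : P *m P^T = 1%:M.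
  apply/row_matrixP => i; rewrite row_mul rowK mPE row1.
  by have [->|->|->] := ord3P i; apply: rV3P; rewrite /= !mxE /=
    ?mm ?bb ?kk ?(dotC m b) ?(dotC k b) ?(dotC k m) ?bm ?bk ?mk.
exists P^T; rewrite trmxK; split; first exact: mulmx1C.
- by rewrite mPE mm (dotC m b) bm mk.
- by rewrite mPE (dotC k m) (dotC k b) mk bk kk.
Qed.

Lemma dot_sqr_le1 u v : dot u u = 1 -> dot v v = 1 -> -1 <= dot u v <= 1.
Proof.
move=> uu vv; have := dot_ge0 (u + v); have := dot_ge0 (u - v).
rewrite !(dotBl, dotBr, dotDl, dotDr) uu vv (dotC v u) => h1 h2; lra.
Qed.

End frames.

(** * Charts *)
Section chart_topology.
Variables (R : realType) (M : topologicalType).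
Implicit Types (c : chart R M) (p : M).

Lemma open_preimage_continuous (S T : topologicalType) (D : set S) (h : S -> T)
  (O : set T) : open D -> (forall x, D x -> {for x, continuous h}) -> open O ->
  open (D `&` h @^-1` O).
Proof.
move=> oD ch oO; rewrite openE => x [Dx Ox]; rewrite /interior.
by apply: filterI; [exact: open_nbhs_nbhs|apply: ch => //; exact: open_nbhs_nbhs].
Qed.

Lemma open_chart_to c (O : set 'rV[R]_2) : open O ->
  open (chart_dom c `&` chart_to c @^-1` O).
Proof.
apply: open_preimage_continuous; first exact: chart_dom_open.
exact: chart_to_continuous.
Qed.

Lemma open_chart_inv c (O : set M) : open O ->
  open (chart_cod c `&` chart_inv c @^-1` O).
Proof.
apply: open_preimage_continuous; first exact: chart_cod_open.
exact: chart_inv_continuous.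
Qed.

Lemma open_rectangle_ball (d : R) :
  open_rectangle (- d) d (- d) d = ball (0 : 'rV[R]_2) d.
Proof. by apply/seteqP; split=> z; rewrite in_ball2. Qed.

(** The components of the new chart are given by equations, so that it can be
    used without unfolding the proofs that it contains. *)
Lemma exists_reparametrized_chart c (U : set 'rV[R]_2) (d : R)
    (g Phi : 'rV[R]_2 -> 'rV[R]_2) :
  open U -> U `<=` chart_cod c -> (forall k, Ck k U Phi) ->
  (forall k, Ck k (ball 0 d) g) ->
  (forall q, U q -> ball 0 d (Phi q) -> g (Phi q) = q) ->
  (forall z, ball 0 d z -> U (g z) /\ Phi (g z) = z) ->
  exists c' : chart R M,
    [/\ chart_dom c' = chart_dom c `&` chart_to c @^-1` (U `&` Phi @^-1` ball 0 d),
        chart_cod c' = open_rectangle (- d) d (- d) d,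
        chart_to c' = Phi \o chart_to c & chart_inv c' = chart_inv c \o g].
Proof.
move=> oU Uc CPhi Cg gK gU.
pose dom := chart_dom c `&` chart_to c @^-1` (U `&` Phi @^-1` ball 0 d).
pose cod := open_rectangle (- d) d (- d) d.
have codE : cod = ball 0 d by exact: open_rectangle_ball.
have cPhi q : U q -> {for q, continuous Phi}.
  by move=> Uq; exact: differentiable_continuous (Ck_diff (CPhi 0%N) Uq).
have cg z : ball 0 d z -> {for z, continuous g}.
  by move=> Bz; exact: differentiable_continuous (Ck_diff (Cg 0%N) Bz).
have dom_open : open dom.
  apply: open_chart_to; apply: (open_preimage_continuous oU cPhi).
  exact: ball_open.
have cod_open : open cod by rewrite codE; exact: ball_open.
have toP p : dom p -> cod ((Phi \o chart_to c) p).
  by move=> [_ [_ Bp]]; rewrite codE.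
have invP v : cod v -> dom ((chart_inv c \o g) v).
  rewrite codE => Bv; have [Ug Pg] := gU _ Bv; have cg' := Uc _ Ug.
  split; first exact: chart_invP.
  by rewrite /= chart_invK // Pg.
have toK p : dom p -> (chart_inv c \o g) ((Phi \o chart_to c) p) = p.
  by move=> [cp [Up Bp]]; rewrite /= gK // chart_toK.
have invK v : cod v -> (Phi \o chart_to c) ((chart_inv c \o g) v) = v.
  rewrite codE => Bv; have [Ug Pg] := gU _ Bv.
  by rewrite /= chart_invK //; exact: Uc.
have to_cont p : dom p -> {for p, continuous (Phi \o chart_to c)}.
  move=> [cp [Up _]]; apply: continuous_comp; first exact: chart_to_continuous.
  exact: cPhi.
have inv_cont v : cod v -> {for v, continuous (chart_inv c \o g)}.
  rewrite codE => Bv; apply: continuous_comp; first exact: cg.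
  by apply: chart_inv_continuous; apply: Uc; have [] := gU _ Bv.
by exists (Chart dom_open cod_open toP invP toK invK to_cont inv_cont).
Qed.

Lemma reparametrized_chart_compatible c c' c'' (U : set 'rV[R]_2) (d : R)
    (g Phi : 'rV[R]_2 -> 'rV[R]_2) :
  (forall k, Ck k U Phi) -> (forall k, Ck k (ball 0 d) g) ->
  (forall z, ball 0 d z -> U (g z)) -> open U -> U `<=` chart_cod c ->
  chart_dom c' = chart_dom c `&` chart_to c @^-1` (U `&` Phi @^-1` ball 0 d) ->
  chart_cod c' = open_rectangle (- d) d (- d) d ->
  chart_to c' = Phi \o chart_to c -> chart_inv c' = chart_inv c \o g ->
  smooth_transition c c'' -> smooth_transition c'' c ->
  smooth_transition c' c'' /\ smooth_transition c'' c'.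
Proof.
move=> CPhi Cg gU oU Uc dE cE tE iE /smooth_onP s1 /smooth_onP s2.
have oc c1 c2 : open (chart_cod c1 `&` chart_inv c1 @^-1` chart_dom c2).
  by apply: open_chart_inv; exact: chart_dom_open.
split; apply/smooth_onP => k.
  have -> : chart_to c'' \o chart_inv c' = (chart_to c'' \o chart_inv c) \o g.
    by rewrite iE.
  apply: (Ck_comp_row (oc _ _) (oc c c'') _ _ (s1 k)).
    by move=> z [+ /=]; rewrite cE open_rectangle_ball iE => /gU/Uc.
  apply: Ck_subset (Cg k) => z [+ _]; by rewrite cE open_rectangle_ball.
have -> : chart_to c' \o chart_inv c'' = Phi \o (chart_to c \o chart_inv c'').
  by rewrite tE.
apply: (Ck_comp_row (oc _ _) oU _ _ (CPhi k)).
  by move=> z [_ /=]; rewrite dE => -[_ []].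
apply: Ck_subset (s2 k) => z [cz /=]; rewrite dE => -[? _]; by split.
Qed.

End chart_topology.

(** * Immersed surfaces *)
Lemma derive_plane (R : realType) (W : normedModType R) (h : 'rV[R]_2 -> W)
    (q v : 'rV[R]_2) : differentiable h q ->
  'D_v h q = v 0 0 *: 'D_dx h q + v 0 1 *: 'D_dy h q.
Proof.
move=> dh; have vE : v = v 0 0 *: dx + v 0 1 *: dy.
  by apply: rV2P; rewrite !mxE /=; ring.
by rewrite !(deriveE _ dh) {1}vE linearP linearZ.
Qed.

Section immersed_surface.
Variables (R : realType) (M : topologicalType) (atlas : set (chart R M)).
Variables (k : 'rV[R]_3) (r N : M -> 'rV[R]_3) (A : M -> 'rV[R]_3 -> 'rV[R]_3).
Hypotheses (hM : smooth_surface atlas) (hk : enorm k = 1).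
Hypotheses (hr : smooth_immersion atlas r) (hN : unit_normal atlas r N).
Hypothesis hA : shape_operator atlas r N A.
Hypothesis htheta : forall p : M, 0 < angle_function N k p < pi /\
                                  angle_function N k p != pi / 2.
Hypothesis hU : canonical_principal_direction A (tangent_part N k).

Implicit Types (c : chart R M) (p : M).

Let kk : dot k k = 1. Proof. exact: enorm1_dot. Qed.

Let NN p : dot (N p) (N p) = 1.
Proof. by case: hN => _ N1 _; exact: enorm1_dot. Qed.

Lemma angle_functionE p : angle_function N k p = acos (dot (N p) k).
Proof.
by rewrite /angle_function /angle hk; case: hN => _ -> _; rewrite mulr1 divr1.
Qed.

Lemma cos_angle_function p : cos (angle_function N k p) = dot (N p) k.
Proof.
by rewrite angle_functionE acosK // in_itv /=; exact: dot_sqr_le1.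
Qed.

Lemma dot_normal_bounds p : -1 < dot (N p) k < 1.
Proof.
have [t0pi _] := htheta p.
have := sin_gt0_pi t0pi; have := cos2Dsin2 (angle_function N k p).
rewrite cos_angle_function; set s := sin _; set x := dot _ _ => h s0.
have : 0 < s ^+ 2 by rewrite exprn_gt0.
by move=> ss; apply/andP; split; nra.
Qed.

Section in_chart.
Variable c : chart R M.
Hypothesis ca : atlas c.
Let f := r \o chart_inv c.
Let n := N \o chart_inv c.
Implicit Types q v : 'rV[R]_2.

Lemma chart_immersion_smooth i : Ck i (chart_cod c) f.
Proof. by case: hr => /(_ _ ca)/smooth_onP. Qed.

Lemma chart_normal_smooth i : Ck i (chart_cod c) n.
Proof. by case: hN => /(_ _ ca)/smooth_onP. Qed.

Lemma chart_deriveE h q v : chart_cod c q ->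
  chart_derive c h (chart_inv c q) v = 'D_v (h \o chart_inv c) q.
Proof. by move=> cq; rewrite /chart_derive chart_invK. Qed.

Lemma chart_normal_tangent q v : chart_cod c q -> dot (n q) ('D_v f q) = 0.
Proof.
move=> cq; case: hN => _ _; apply; exists c, v.
by rewrite chart_deriveE //; split=> //; exact: chart_invP.
Qed.

Lemma chart_immersion_injective q v : chart_cod c q -> 'D_v f q = 0 -> v = 0.
Proof.
move=> cq; case: hr => _ inj Dv; apply: (inj c (chart_inv c q) v ca).
  exact: chart_invP.
by rewrite chart_deriveE.
Qed.

Lemma chart_shape q v : chart_cod c q ->
  'D_v n q = - A (chart_inv c q) ('D_v f q).
Proof.
move=> cq; have := @hA c (chart_inv c q) v ca (chart_invP cq).
by rewrite !chart_deriveE.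
Qed.

(** A tangent vector may be presented in any chart of the atlas; the chain rule
    for the transition map brings it to c. *)
Lemma tangent_chart p X : chart_dom c p -> tangent atlas r p X ->
  exists v, X = 'D_v f (chart_to c p).
Proof.
move=> cp [c' [v [c'a c'p ->]]].
case: hM => _ _ _ /(_ _ _ c'a ca)/smooth_onP sT.
pose D := chart_cod c' `&` chart_inv c' @^-1` chart_dom c.
have oD : open D by apply: open_chart_inv; exact: chart_dom_open.
have Dp : D (chart_to c' p).
  by split; [exact: chart_toP|rewrite /= chart_toK].
have dT := Ck_diff (sT 0%N) Dp.
have Tp : (chart_to c \o chart_inv c') (chart_to c' p) = chart_to c p.
  by rewrite /= chart_toK.
have df : differentiable f ((chart_to c \o chart_inv c') (chart_to c' p)).
  by rewrite Tp; apply: (Ck_diff (chart_immersion_smooth 0)); exact: chart_toP.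
exists ('D_v (chart_to c \o chart_inv c') (chart_to c' p)).
rewrite /chart_derive -Tp -(derive_comp v dT df).
apply: (open_eq_derive v oD Dp) => x [_ /= Dx].
by rewrite /f /= chart_toK.
Qed.

Lemma degenerate_chart p : chart_dom c p ->
  degenerate atlas r A p <-> exists2 v, v != 0 & 'D_v n (chart_to c p) = 0.
Proof.
move=> cp; have cq := chart_toP cp; split.
  move=> [X [tX X0 AX]]; have [v XE] := tangent_chart cp tX.
  exists v; last by rewrite chart_shape // chart_toK // -XE AX oppr0.
  by apply: contra_neq X0 => v0; rewrite XE v0 derive0.
move=> [v v0 Dv]; exists ('D_v f (chart_to c p)); split.
- by exists c, v; split=> //; rewrite /chart_derive.
- by apply: contra_neq v0; exact: chart_immersion_injective.
- have := chart_shape v cq; rewrite Dv chart_toK // => /esym/eqP.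
  by rewrite oppr_eq0 => /eqP.
Qed.

Let gauss_rows q := rows3 ('D_dx n q) ('D_dy n q) (n q).

(** This turns nondegeneracy at p into the nonvanishing of a continuous function
    of p. *)
Lemma nondegenerate_chart p : chart_dom c p ->
  ~ degenerate atlas r A p <-> \det (gauss_rows (chart_to c p)) != 0.
Proof.
move=> cp; have cq := chart_toP cp.
have dn := Ck_diff (chart_normal_smooth 0) cq.
have nD v : dot (n (chart_to c p)) ('D_v n (chart_to c p)) = 0.
  apply: (normal_derive_normal (V := chart_cod c)) => //.
  - exact: chart_cod_open.
  - exact: chart_normal_smooth.
  - by move=> q _; exact: NN.
have nn : dot (n (chart_to c p)) (n (chart_to c p)) = 1 by exact: NN.
rewrite -unitfE -unitmxE degenerate_chart //; split.
  move=> nd; apply/(rows3_unitmxP nn (nD _) (nD _)) => x y xy.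
  have [v0|v0] := eqVneq (vec2 x y) 0.
    by have /rowP h := v0; have := h 0; have := h 1; rewrite vec2_0 vec2_1 !mxE.
  by case: nd; exists (vec2 x y) => //; rewrite derive_plane // vec2_0 vec2_1.
move=> /(rows3_unitmxP nn (nD _) (nD _)) inj [v v0]; rewrite derive_plane //.
move=> /inj[h0 h1]; move/eqP: v0; apply; by apply: rV2P; rewrite mxE.
Qed.

Lemma Ck_gauss_rows i j j' : Ck i (chart_cod c) (fun q => gauss_rows q j j').
Proof.
have oc := @chart_cod_open _ _ c.
have Cj (h : 'rV[R]_2 -> 'rV[R]_3) : Ck i (chart_cod c) h ->
    Ck i (chart_cod c) (fun q => h q 0 j') by exact: Ck_coord.
have CD v := Cj _ (Ck_derive v (chart_normal_smooth i.+1)).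
have [->|->|->] := ord3P j.
- by apply: (Ck_eq oc _ (CD dx)) => q _; rewrite !mxE.
- by apply: (Ck_eq oc _ (CD dy)) => q _; rewrite !mxE.
- by apply: (Ck_eq oc _ (Cj _ (chart_normal_smooth i))) => q _; rewrite !mxE.
Qed.

(** The tangential part of k lies in the image of dr, so that the principal
    direction hypothesis concerns a vector of the parameter plane. *)
Lemma chart_principal q : chart_cod c q -> exists u (kappa : R),
  [/\ kappa != 0, 'D_u f q = k - dot (n q) k *: n q &
      'D_u n q = - (kappa *: 'D_u f q)].
Proof.
move=> cq; have [kappa [Ak k0]] := hU.
have df := Ck_diff (chart_immersion_smooth 0) cq.
have nn : dot (n q) (n q) = 1 by exact: NN.
have inj x y : x *: 'D_dx f q + y *: 'D_dy f q = 0 -> x = 0 /\ y = 0.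
  move=> xy; have /rowP h : vec2 x y = 0.
    apply: (chart_immersion_injective cq).
    by rewrite (derive_plane _ df) vec2_0 vec2_1.
  by have := h 0; have := h 1; rewrite vec2_0 vec2_1 !mxE.
have nU : dot (n q) (k - dot (n q) k *: n q) = 0.
  by rewrite dotBr dotZr nn mulr1 subrr.
have [x [y xyE]] := tangent_plane_span nn (chart_normal_tangent dx cq)
  (chart_normal_tangent dy cq) inj nU.
have Uf : 'D_(vec2 x y) f q = k - dot (n q) k *: n q.
  by rewrite (derive_plane _ df) vec2_0 vec2_1.
exists (vec2 x y), (kappa (chart_inv c q)); split=> //.
rewrite (chart_shape _ cq) Uf; have := Ak (chart_inv c q).
by rewrite /tangent_part cos_angle_function => ->.
Qed.

End in_chart.

Lemma nondegenerate_open : open (~` degenerate atlas r A).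
Proof.
case: hM => _ _ cover _.
rewrite openE => p /= nd; rewrite /interior.
have [c ca cp] := cover p.
pose G q := rows3 ('D_dx (N \o chart_inv c) q) ('D_dy (N \o chart_inv c) q)
  ((N \o chart_inv c) q).
have oc := @chart_cod_open _ _ c.
have CG : Ck 0 (chart_cod c) (fun q => \det (G q)).
  by apply: (Ck_det oc) => i j; exact: Ck_gauss_rows.
pose O := chart_cod c `&` (fun q => \det (G q)) @^-1` [set x : R | x != 0].
have oO : open O by apply: (open_preimage_on oc CG); exact: open_neq.
have oW : open (chart_dom c `&` chart_to c @^-1` O) by exact: open_chart_to.
apply: (filterS (P := chart_dom c `&` chart_to c @^-1` O)).
  by move=> x [cx [_ /= Gx]]; apply/(nondegenerate_chart ca cx).
apply: open_nbhs_nbhs; split=> //; split=> //; split; first exact: chart_toP.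
exact/(nondegenerate_chart ca cp).
Qed.

Lemma generic_locus_open : open (generic_locus atlas r A).
Proof. by apply: openU; [exact: nondegenerate_open|exact: open_interior]. Qed.

(** An open set contained in the degenerate locus lies in its interior. *)
Lemma generic_locus_dense : dense (generic_locus atlas r A).
Proof.
move=> O [p Op] oO.
have [Od|nOd] := pselect (O `<=` degenerate atlas r A).
  exists p; split=> //; right.
  by rewrite /interior; apply: filterS Od _; exact: open_nbhs_nbhs.
have [q [Oq nq]] : exists q, O q /\ ~ degenerate atlas r A q.
  apply: contrapT => h; apply: nOd => q Oq; apply: contrapT => nq.
  by apply: h; exists q.
by exists q; split=> //; left.
Qed.

(** The first vector of the frame is the horizontal direction opposite to the
    normal, which makes the polar angle of the normal vanish at p. *)
Lemma exists_adapted_frame p : exists K : 'M[R]_3,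
  [/\ K *m K^T = 1%:M, k *m K = vec3 0 0 1,
      (N p *m K) 0 0 < 0 & (N p *m K) 0 1 = 0].
Proof.
have /andP[h1 h2] := dot_normal_bounds p.
set x := dot (N p) k in h1 h2.
pose s := Num.sqrt (1 - x ^+ 2).
have ss : s ^+ 2 = 1 - x ^+ 2 by rewrite sqr_sqrtr //; nra.
have s0 : 0 < s by rewrite sqrtr_gt0; nra.
pose m := s^-1 *: (x *: k - N p).
have mk : dot m k = 0.
  by rewrite /m dotZl dotBl dotZl kk mulr1 subrr mulr0.
have mm : dot m m = 1.
  rewrite /m dotZl dotZr dotBl !dotBr !dotZl !dotZr kk NN (dotC k) -/x.
  transitivity (s^-1 * s^-1 * (1 - x ^+ 2)); first by ring.
  by rewrite -ss; field; rewrite gt_eqF.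
have [K [KK mK kK]] := exists_orthogonal_frame kk mm mk.
have NE : N p = x *: k - s *: m.
  by rewrite /m scalerA divff ?gt_eqF // scale1r opprB addrC subrK.
have NK : N p *m K = x *: vec3 0 0 1 - s *: vec3 1 0 0.
  by rewrite NE mulmxBl -(scalemxAl x k) -(scalemxAl s m) mK kK.
exists K; split=> //; rewrite NK !mxE /=.
  by rewrite mulr0 mulr1 sub0r oppr_lt0.
by rewrite !mulr0 subr0.
Qed.

(** Near a generic point the Gauss map is nondegenerate everywhere or nowhere.
    In the frame K adapted to p the immersion and the normal satisfy the
    hypotheses of the planar analysis, and the coordinates found there are
    composed with the chart c. *)
Lemma generic_normal_form p : generic_locus atlas r A p ->
  local_normal_form atlas k r N p.
Proof.
move=> gp; case: hM => _ _ cover compat.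
have [c ca cp] := cover p.
have [K [KK kK N1 N2]] := exists_adapted_frame p.
have [W [oW Wp gauss]] : exists W : set M, [/\ open W, W p &
    W `<=` ~` degenerate atlas r A \/ W `<=` degenerate atlas r A].
  case: gp => [nd|dp].
    exists (~` degenerate atlas r A); split=> //; first exact: nondegenerate_open.
    by left.
  exists (degenerate atlas r A)°; split=> //; first exact: open_interior.
  by right; exact: interior_subset.
pose V := chart_cod c `&` chart_inv c @^-1` W.
have oV : open V by exact: open_chart_inv.
have Vc q : V q -> chart_cod c q by case.
pose q0 := chart_to c p.
have Vq0 : V q0 by split; [exact: chart_toP|rewrite /= chart_toK].
pose F (u : 'rV[R]_3) := (u - r p) *m K.
pose f0 := r \o chart_inv c; pose n0 := N \o chart_inv c.
pose f q := F (f0 q); pose n q := n0 q *m K.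
have Cf0 i : Ck i V f0 := Ck_subset (@subIsetl _ _ _) (chart_immersion_smooth ca i).
have Cn0 i : Ck i V n0 := Ck_subset (@subIsetl _ _ _) (chart_normal_smooth ca i).
have df0 q : V q -> differentiable f0 q := Ck_diff (Cf0 0%N).
have dn0 q : V q -> differentiable n0 q := Ck_diff (Cn0 0%N).
have cK : continuous (mulmxr K : {linear 'rV[R]_3 -> 'rV[R]_3}).
  exact: linear_rV_continuous.
have Cn i : Ck i V n by exact: Ck_mulmxr.
have Cf i : Ck i V f.
  apply: Ck_mulmxr => //.
  exact: (CkD oV (Cf0 i) (@Ck_cst _ _ 'rV[R]_3 i V (- r p))).
have Dn q v : V q -> 'D_v n q = 'D_v n0 q *m K.
  by move=> Vq; exact: (derive_linear_comp v cK (dn0 _ Vq)).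
have Df q v : V q -> 'D_v f q = 'D_v f0 q *m K.
  move=> Vq; transitivity ('D_v (f0 - cst (r p)) q *m K).
    apply: (derive_linear_comp v cK); apply: differentiableB => //.
    exact: df0.
  congr (_ *m K); rewrite deriveB ?derive_cst ?subr0 //.
  by apply: diff_derivable; exact: df0.
have K0 u : u *m K = 0 -> u = 0.
  by move=> uK; rewrite -[u]mulmx1 -KK mulmxA uK mul0mx.
have n_unit q : V q -> dot (n q) (n q) = 1.
  by move=> _; rewrite dot_orthogonal // NN.
have n_normal q v : V q -> dot (n q) ('D_v f q) = 0.
  move=> Vq; rewrite Df // dot_orthogonal //.
  exact: (chart_normal_tangent ca v (Vc _ Vq)).
have nk q : n q 0 2 = dot (n0 q) k.
  by rewrite -(dot_orthogonal _ _ KK) kK dotE vec3_0 vec3_1 vec3_2 !mulr0 !add0r mulr1.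
have slope q : V q -> -1 < n q 0 2 < 1.
  by move=> _; rewrite nk; exact: dot_normal_bounds.
have imm q v : V q -> 'D_v f q = 0 -> v = 0.
  move=> Vq; rewrite Df // => /K0.
  exact: (chart_immersion_injective ca (Vc _ Vq)).
have princ q : V q -> exists u kappa, vertical_principal f n q u kappa.
  move=> Vq; have [u [kappa [k0 Uf Un]]] := chart_principal ca (Vc _ Vq).
  exists u, kappa; split; first exact: k0.
    by rewrite (Df _ _ Vq) Uf mulmxBl -scalemxAl kK nk.
  by rewrite (Dn _ _ Vq) Un (Df _ _ Vq) mulNmx -scalemxAl.
have cq q : V q -> chart_to c (chart_inv c q) = q by move=> /Vc; exact: chart_invK.
have dq q : V q -> chart_dom c (chart_inv c q) by move=> /Vc; exact: chart_invP.
have gaussV : (forall q v, V q -> 'D_v n q = 0 -> v = 0) \/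
    (forall q, V q -> exists2 w, w != 0 & 'D_w n q = 0).
  case: gauss => WD; [left=> q v|right=> q] => Vq.
    rewrite Dn // => /K0 Dv; apply/eqP; apply: contraPT isT => v0 _.
    have [_ Wq] := Vq; apply: (WD _ Wq); apply/(degenerate_chart ca (dq _ Vq)).
    by exists v; [exact: v0|rewrite cq].
  have [_ Wq] := Vq; have /(degenerate_chart ca (dq _ Vq))[w w0] := WD _ Wq.
  by rewrite cq // => Dw; exists w => //; rewrite Dn // [X in X *m K]Dw mul0mx.
have f00 : f q0 = 0 by rewrite /f /f0 /= chart_toK // /F subrr mul0mx.
have n00 : n q0 = N p *m K by rewrite /n /n0 /= chart_toK.
have [||U [d [g [Phi [theta [phi
  [[oU Uq0 UV [d0 BPhi]] [CPhi Cg gK gU] [Ct tE Dphi] form]]]]]]] :=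
  patch_normal_form_exists oV Vq0 Cf Cn n_unit n_normal princ slope imm f00 _ _
    gaussV.
- by rewrite n00.
- by rewrite n00.
have Uc : U `<=` chart_cod c by move=> q /UV/Vc.
have [xy [dE cE tE' iE]] := exists_reparametrized_chart oU Uc CPhi Cg gK gU.
exists xy, F, (- d), d, (- d), d, theta, phi; split.
- split; last by rewrite dE; split.
  move=> c' c'a.
  apply: (reparametrized_chart_compatible CPhi Cg _ oU Uc dE cE tE' iE).
  + by move=> z /gU[].
  + exact: compat.
  + exact: compat.
- by split; rewrite oppr_lt0 d0.
- exact: cE.
- split=> [u v|u]; last by rewrite /F addrAC mulmxDl kK.
  by rewrite /enorm /F -mulmxBl dot_orthogonal //; congr (Num.sqrt (dot _ _));
     rewrite opprB addrA subrK.
split.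
- exact/smooth_onP.
- move=> v; rewrite cE open_rectangle_ball iE => Bv.
  by rewrite angle_functionE -tE // nk.
- by move=> x /=; rewrite in_itv /=; exact: Dphi.
case: form => [[psi Cpsi fE]|fE]; [left|right].
  exists psi; first exact/smooth_onP.
  by move=> v; rewrite cE open_rectangle_ball iE => /fE <-.
by exists 0 => v; rewrite cE open_rectangle_ball iE => /fE <-.
Qed.

End immersed_surface.

Theorem theorem2 (R : realType) (M : topologicalType)
    (atlas : set (chart R M)) (k : 'rV[R]_3) (r N : M -> 'rV[R]_3)
    (A : M -> 'rV[R]_3 -> 'rV[R]_3)
    (hM : smooth_surface atlas)
    (hk : enorm k = 1)
    (hr : smooth_immersion atlas r)
    (hN : unit_normal atlas r N)
    (hA : shape_operator atlas r N A)
    (htheta : forall p : M, 0 < angle_function N k p < pi /\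
                            angle_function N k p != pi / 2)
    (hU : canonical_principal_direction A (tangent_part N k)) :
  [/\ open (generic_locus atlas r A),
      dense (generic_locus atlas r A) &
      forall p : M, generic_locus atlas r A p ->
        local_normal_form atlas k r N p].
Proof.
split.
- exact: (generic_locus_open hM hr hN hA).
- exact: generic_locus_dense.
- by move=> p; exact: generic_normal_form.
Qed.
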